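(* Let $r\in\mathbb{Z}_{\ge 2}$, $\mathbf{a}=(a_1,\ldots,a_r)\in\mathbb{Z}_{\ge1}^r$, $\mathbf{m}=(m_1,\ldots,m_r)\in\mathbb{Z}_{\ge1}^r$, $\mathbf{w}=(w_1,\ldots,w_r)\in\mathfrak{R}^r$, and $\mathbf{j}=(j_{\mathrm{I}},j_{\mathrm{II}})\in\mathbb{Z}_{\ge0}^2$ with $j_{\mathrm{I}}+j_{\mathrm{II}}=r$. Let $|\mathbf{m}|:=m_1+\cdots+m_r$. In the sums below $\rho$ runs over all poles in $\mathfrak{R}$ of $$\Phi^{(\mathbf{j})}(z;\mathbf{a},\mathbf{m},\mathbf{w}):=\prod_{l=1}^{r}a_l^{m_l}\varphi_{m_l}^{(\mathbf{j},l)}(a_lz-w_l).$$ (1) We have $$\sum_{\rho}\sum_{\Lambda\in R_\rho}\sum_{(\nu_k)_{k\in\Lambda^c}\in K_{1,\Lambda}^{-}}\ \prod_{l\in\Lambda}(-1)^{(a_l\rho-w_l)\delta_{\mathrm{II}}^{(\mathbf{j},l)}}\prod_{u\in\Lambda^c}A_{\nu_u}^{(\mathbf{j},u)}(\rho;a_u,m_u,w_u)=\pi^{r-1}\sin\left(\frac{\pi r}{2}\right)\delta_{j_{\mathrm{II}},0}\prod_{l=1}^{r}a_l\delta_{m_l,1}.$$ (2) Let $J=\mathrm{I}$ in Case I and $J=\mathrm{II}$ in Case II. For any $z_0\in\mathbb{C}$ and $\mu\in\mathbb{Z}_{\ge0}$, $$\sum_{n=1}^{|\mathbf{m}|}\sum_{\rho}\sum_{\Lambda\in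 R_\rho}\sum_{(\nu_k)_{k\in\Lambda^c}\in K_{n,\Lambda}^{-}}\ \prod_{l\in\Lambda}(-1)^{(a_l\rho-w_l)\delta_{\mathrm{II}}^{(\mathbf{j},l)}}\left\{\prod_{u\in\Lambda^c}A_{\nu_u}^{(\mathbf{j},u)}(\rho;a_u,m_u,w_u)\right\}A_\mu^{(J)}(z_0;1,n,\rho)$$ $$=-\cos\left(\frac{\pi r}{2}\right)\pi^r\delta_{\mu,0}\delta_{j_{\mathrm{II}},0}\prod_{l=1}^{r}a_l\delta_{m_l,1}+\sum_{\Lambda\in R_{z_0}}\sum_{(\nu_k)_{k\in\Lambda^c}\in K_{\mu,\Lambda}^{+}}\ \prod_{l\in\Lambda}(-1)^{(a_lz_0-w_l)\delta_{\mathrm{II}}^{(\mathbf{j},l)}}\prod_{u\in\Lambda^c}A_{\nu_u}^{(\mathbf{j},u)}(z_0;a_u,m_u,w_u).$$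
   Context: $\mathfrak{R}:=\{z\in\mathbb{C}\mid 0\le \mathrm{Re}\,z<1\}$. $\mathrm{I}$ and $\mathrm{II}$ are two formal labels; $\delta_{x,y}$ is the Kronecker delta. Empty products are $1$ and empty sums are $0$. For $N\in\mathbb{Z}_{\ge1}$, $J\in\{\mathrm{I},\mathrm{II}\}$ and $z\in\mathbb{C}\setminus\mathbb{Z}$, $$\varphi_N^{(J)}(z):=\frac{1}{z^N}+\sum_{n=1}^{\infty}(-1)^{n\delta_{J,\mathrm{II}}}\left(\frac{1}{(z+n)^N}+\frac{1}{(z-n)^N}\right)$$ (so $\varphi_1^{(\mathrm{I})}(z)=\pi\cot(\pi z)$, $\varphi_1^{(\mathrm{II})}(z)=\pi\csc(\pi z)$). With $\zeta$ the Riemann zeta function and $\mu\ge1$: $\alpha_\mu^{(\mathrm{I})}:=2\zeta(\mu)$ and $\alpha_\mu^{(\mathrm{II})}:=-2(1-2^{1-\mu})\zeta(\mu)$ if $\mu$ is even; $\alpha_\mu^{(\mathrm{I})}=\alpha_\mu^{(\mathrm{II})}:=0$ if $\mu$ is odd. $(m)_\nu:=m(m+1)\cdots(m+\nu-1)$ for $\nu\ge1$, $(m)_0:=1$. For $z_0,w\in\mathbb{C}$, $a\in\mathbb{Z}_{\ge1}$: $\mathrm{sgn}^{(J)}(z_0;a,w):=(-1)^{(az_0-w)\delta_{J,\mathrm{II}}}$ if $az_0-w\in\mathbb{Z}$, and $:=0$ otherwise. For $a,m\in\mathbb{Z}_{\ge1}$, $\nu\in\mathbb{Z}_{\ge0}$,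 $w,z_0\in\mathbb{C}$, $$A_\nu^{(J)}(z_0;a,m,w):=\begin{cases}(-1)^m\,\mathrm{sgn}^{(J)}(z_0;a,w)\binom{m+\nu-1}{m-1}\alpha_{m+\nu}^{(J)}a^{m+\nu}&(az_0-w\in\mathbb{Z}),\\ (-1)^\nu\frac{(m)_\nu}{\nu!}\varphi_{m+\nu}^{(J)}(az_0-w)\,a^{m+\nu}&(az_0-w\notin\mathbb{Z}).\end{cases}$$ Let $[r]:=\{1,\ldots,r\}$. Put $\delta_{\mathrm{II}}^{(\mathbf{j},l)}:=1$ if $j_{\mathrm{I}}+1\le l\le r$ and $:=0$ if $1\le l\le j_{\mathrm{I}}$. For $l\in[r]$, $\varphi_N^{(\mathbf{j},l)}$ and $A_\nu^{(\mathbf{j},l)}$ denote $\varphi_N^{(\mathrm{I})}$ and $A_\nu^{(\mathrm{I})}$ if $1\le l\le j_{\mathrm{I}}$, and $\varphi_N^{(\mathrm{II})}$ and $A_\nu^{(\mathrm{II})}$ if $j_{\mathrm{I}}+1\le l\le r$. For $\rho\in\mathbb{C}$, $R_\rho:=\{\Lambda\subset[r]\mid a_\lambda\rho-w_\lambda\in\mathbb{Z}\text{ for all }\lambda\in\Lambda\}$ (the empty set belongs to $R_\rho$). $\Lambda^c:=[r]\setminus\Lambda$, and $$K_{n,\Lambda}^{\pm}:=\left\{(\nu_k)_{k\in\Lambda^c}\in\mathbb{Z}_{\ge0}^{|\Lambda^c|}\ \Big|\ n=\pm\left(\sum_{k\in\Lambda^c}\nu_k-\sum_{\lambda\in\Lambda}m_\lambda\right)\right\};$$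 if $\Lambda^c=\emptyset$, this set consists of the empty tuple when the defining equation holds and is empty otherwise. Case I: $j_{\mathrm{II}}=0$ or $\sum_{l=j_{\mathrm{I}}+1}^{r}a_l$ is even. Case II: $\sum_{l=j_{\mathrm{I}}+1}^{r}a_l$ is odd.
   Formalization: Part (1) is proved only in Case I (j_II = 0 or the sum of a_l over l > j_I even); unrestricted it fails in Case II, e.g. r=2, j=(1,1), a=m=(1,1), w=(1/2,0), where the left side is π and the right side is 0. *)

(* Defs.v *)
From HB Require Import structures.
From mathcomp Require Import all_boot all_order all_algebra.
From mathcomp Require Import complex.
From mathcomp Require Import all_classical all_reals all_analysis.

Set Implicit Arguments.
Unset Strict Implicit.
Unset Printing Implicit Defensive.

Import Order.TTheory GRing.Theory Num.Theory.
Import numFieldNormedType.Exports.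

Local Open Scope classical_set_scope.
Local Open Scope complex_scope.
Local Open Scope ring_scope.

(* The topology and norm that every numFieldType carries, made canonical on
   R[i]. *)
HB.instance Definition _ (R : rcfType) :=
  NormedModule.copy R[i] [the numFieldType of R[i]]^o.

Inductive label := I | II.

Definition isII (J : label) : bool := if J is II then true else false.

Section Definitions.
Variable R : realType.
Local Notation C := R[i].

Definition integral (z : C) : Prop := exists k : int, z = k%:~R.

(* (-1)^(z * d), where d is a Kronecker delta; it is only meaningful when z is
   an integer, in which case z is the floor of its real part. *)
Definition signpow (d : bool) (z : C) : C :=
  (-1) ^ (Num.floor (complex.Re z) * Posz d).

Definition strip : set C := [set z | 0 <= complex.Re z < 1].

Definition phi (J : label) (N : nat) (z : C) : C :=
  z ^- N + limn (fun M => \sum_(1 <= n < M)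
    (-1) ^+ (n * isII J) * ((z + n%:R) ^- N + (z - n%:R) ^- N)).

(* Dirichlet series of the Riemann zeta function; only its values at even
   integers s >= 2 are used. *)
Definition zeta (s : nat) : R :=
  limn (fun M => \sum_(1 <= n < M) (n%:R : R) ^- s).

Definition alpha (J : label) (mu : nat) : C :=
  if odd mu then 0
  else match J with
       | I => (2 * zeta mu)%:C
       | II => (- 2 * (1 - 2 ^ (1 - Posz mu)) * zeta mu)%:C
       end.

Definition rising (m nu : nat) : nat := (\prod_(0 <= i < nu) (m + i))%N.

Definition sgn (J : label) (z0 : C) (a : nat) (w : C) : C :=
  if `[< integral (a%:R * z0 - w) >] then signpow (isII J) (a%:R * z0 - w)
  else 0.

Definition A (J : label) (nu : nat) (z0 : C) (a m : nat) (w : C) : C :=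
  if `[< integral (a%:R * z0 - w) >] then
    (-1) ^+ m * sgn J z0 a w * 'C((m + nu).-1, m.-1)%:R
      * alpha J (m + nu) * a%:R ^+ (m + nu)
  else
    (-1) ^+ nu * ((rising m nu)%:R / nu`!%:R)
      * phi J (m + nu) (a%:R * z0 - w) * a%:R ^+ (m + nu).

(* Poles of a partial function presented as a total one: the value of f at p
   itself plays no role. *)
Definition is_pole (f : C -> C) (p : C) : Prop :=
  (\forall z \near p^', derivable f z 1) /\ (`|f z| : C) @[z --> p^'] --> +oo.

Section Family.
Variables (r jI : nat) (a m : 'I_r -> nat) (w : 'I_r -> C).

(* Indices are shifted by one: l : 'I_r stands for l + 1 in {1, ..., r}. *)
Definition deltaII (l : 'I_r) : bool := (jI <= l)%N.

Definition lab (l : 'I_r) : label := if deltaII l then II else I.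

Definition Phi (z : C) : C :=
  \prod_(l < r) ((a l)%:R ^+ m l * phi (lab l) (m l) ((a l)%:R * z - w l)).

Definition poles : set C := [set rho | strip rho /\ is_pole Phi rho].

Definition Rset (rho : C) : {set {set 'I_r}} :=
  finset (fun L : {set 'I_r} =>
    `[< forall l, l \in L -> integral ((a l)%:R * rho - w l) >]).

(* Tuples of natural numbers indexed by the complement of L. *)
Definition ctuple (L : {set 'I_r}) : Type :=
  {ffun {k : 'I_r | k \in ~: L} -> nat}.
HB.instance Definition _ L := Choice.on (ctuple L).

Definition Kplus (n : nat) (L : {set 'I_r}) : set (ctuple L) :=
  [set nu | Posz n =
     (\sum_k Posz (nu k)) - \sum_(l in L) Posz (m l)].

Definition Kminus (n : nat) (L : {set 'I_r}) : set (ctuple L) :=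
  [set nu | Posz n =
     - ((\sum_k Posz (nu k)) - \sum_(l in L) Posz (m l))].

Definition summand (z : C) (L : {set 'I_r}) (nu : ctuple L) : C :=
  (\prod_(l in L) signpow (deltaII l) ((a l)%:R * z - w l))
  * \prod_(u : {k : 'I_r | k \in ~: L})
      A (lab (val u)) (nu u) z (a (val u)) (m (val u)) (w (val u)).

(* In case I, Phi (z + 1) = Phi z; otherwise Phi (z + 1) = - Phi z.  In the
   second situation the residues of Phi in the strip need not obey a residue
   theorem: for instance with r = 2, jI = 1, a = m = (1, 1), w = (1/2, 0) the
   function Phi is - pi^2 / cos (pi z), with the single residue pi. *)
Definition caseI (jII : nat) : bool :=
  (jII == 0%N) || ~~ odd (\sum_(l < r | deltaII l) a l).

End Family.
End Definitions.

Arguments Kplus {r} m n L.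
Arguments Kminus {r} m n L.

(* Main.v *)
(* Near any point [z], each factor [a ^ m * phi m (a * (z + t) - w)] of [Phi] is
   a polar term plus the power series in [t] with coefficients [A nu z a m w];
   multiplying these expansions out, the inner sums of the theorem are the
   Laurent coefficients of [Phi].  Since the Laurent coefficients in the strip
   determine the polar parts of [Phi] everywhere (up to the sign of
   [Phi (z + 1) = +/- Phi z]), subtracting from [Phi] the functions
   [phi J n (z - rho)] weighted by its polar coefficients at the poles [rho]
   leaves a function without singularities.  It has period 2 and, because
   [phi I 1] tends to [-/+ i pi] and every other [phi J n] to 0 as the imaginary
   part goes to [+/- oo], a limit at both ends of the strip.  By the maximum
   principle such a function equals the mean of its two limits, so the limits
   agree; that the limits agree is part (1), and comparing Taylor coefficients
   with those of a constant is part (2).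

   With the convention [1 / 0 = 0], the value of [phi J N] at an integer is the
   constant term of its Laurent expansion there, so that both cases in the
   definition of [A] are instances of one formula ([A_phi_coef]). *)

(* Analyticity enters only through [jet]: agreement with a polynomial up to [O(t ^ K)] near a point.
   Jets are stable under sums, products and division by [t ^ M], which is what multiplying
   expansions and cancelling polar parts require. They also feed the maximum principle: the second
   difference of a quadratic polynomial over the directions 1, -1, i, -i vanishes, so a jet of order
   3 makes real parts harmonic up to [O(s ^ 3)].

   The function left after the subtraction is not extended by limits: its value at a singular point
   is given by the formula [reg_coef 0], which makes sense everywhere and has the [reg_coef mu] as
   Taylor coefficients.

   A singular point of one factor need not be a pole of [Phi], since a zero of another factor may
   cancel it. The argument therefore sums over the finite list [candidates]; at a candidate that is
   not a pole the polar coefficients vanish.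

   Part (1) is confined to Case I because otherwise [J] is [II], all subtracted functions tend to 0
   at both ends, and comparing the two limits says nothing about residues. *)
Require Import Defs.
From HB Require Import structures.
From mathcomp Require Import all_boot all_order all_algebra.
From mathcomp Require Import complex.
From mathcomp Require Import all_classical all_reals all_analysis.
From mathcomp Require Import ring lra zify.
Set Implicit Arguments.
Unset Strict Implicit.
Unset Printing Implicit Defensive.
Import Order.TTheory GRing.Theory Num.Theory.
Import numFieldNormedType.Exports Normc.
Local Open Scope classical_set_scope.
Local Open Scope complex_scope.
Local Open Scope ring_scope.
Local Notation Re := complex.Re.
Local Notation Im := complex.Im.

(** * Complex norms and series *)

Section Cbasics.
Variable R : realType.
Local Notation C := R[i].
Implicit Types (x y z : C).

Lemma normcE z : `|z| = (normc z)%:C.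
Proof. by []. Qed.

Lemma normc_ge0 z : 0 <= normc z.
Proof. by rewrite -lecR -normcE normr_ge0. Qed.

Lemma normc_eq0 z : (normc z == 0) = (z == 0).
Proof. by rewrite -(inj_eq (@complexI R)) -normcE normr_eq0. Qed.

Lemma normc_gt0 z : (0 < normc z) = (z != 0).
Proof. by rewrite lt_neqAle normc_ge0 andbT eq_sym normc_eq0. Qed.

Lemma normcX z n : normc (z ^+ n) = normc z ^+ n.
Proof. by apply: (@complexI R); rewrite rmorphXn -!normcE normrX. Qed.

Lemma normcBC x y : normc (x - y) = normc (y - x).
Proof. by rewrite -normcN opprB. Qed.

Lemma le_normcB x y : normc (x - y) <= normc x + normc y.
Proof. by rewrite -(normcN y) le_normcD. Qed.

Lemma ler_distc x y : normc x - normc y <= normc (x - y).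
Proof. by rewrite lerBlDr -{1}(subrK y x) le_normcD. Qed.

Lemma normc_real (a : R) : normc a%:C = `|a|.
Proof. by rewrite /normc /= expr0n /= addr0 sqrtr_sqr. Qed.

Lemma natC n : n%:R = real_complex R n%:R.
Proof. by rewrite rmorph_nat. Qed.

Lemma intC (k : int) : k%:~R = real_complex R k%:~R.
Proof. by rewrite rmorph_int. Qed.

Lemma normc_nat n : @normc R n%:R = n%:R.
Proof. by rewrite natC normc_real normr_nat. Qed.

Lemma normc_sq z : normc z ^+ 2 = Re z ^+ 2 + Im z ^+ 2.
Proof. by case: z => a b /=; rewrite sqr_sqrtr // addr_ge0 // sqr_ge0. Qed.

Lemma Re_le_normc z : `|Re z| <= normc z.
Proof. by rewrite -lecR -normcE normc_ge_Re. Qed.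

Lemma Im_le_normc z : `|Im z| <= normc z.
Proof.
rewrite -(@ler_pXn2r _ 2%N) ?nnegrE ?normc_ge0 ?normr_ge0 //.
by rewrite normc_sq real_normK ?num_real // lerDr sqr_ge0.
Qed.

Lemma normc_le_ReIm z : normc z <= `|Re z| + `|Im z|.
Proof.
rewrite {1}(complexE z); apply: le_trans (le_normcD _ _) _.
by rewrite normcM !normc_real /= expr0n expr1n add0r sqrtr1 mul1r.
Qed.

Lemma ReD x y : Re (x + y) = Re x + Re y.
Proof. by case: x y => [? ?] [? ?]. Qed.

Lemma ImD x y : Im (x + y) = Im x + Im y.
Proof. by case: x y => [? ?] [? ?]. Qed.

Lemma ReN x : Re (- x) = - Re x.
Proof. by case: x. Qed.

Lemma ImN x : Im (- x) = - Im x.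
Proof. by case: x. Qed.

Lemma ReMr (a : R) x : Re (a%:C * x) = a * Re x.
Proof. by case: x => b c /=; rewrite mul0r subr0. Qed.

Lemma ImMr (a : R) x : Im (a%:C * x) = a * Im x.
Proof. by case: x => b c /=; rewrite mul0r addr0. Qed.

Lemma Re_sum I (r : seq I) (P : pred I) (F : I -> C) :
  Re (\sum_(i <- r | P i) F i) = \sum_(i <- r | P i) Re (F i).
Proof. by apply: (big_morph _ ReD). Qed.

Lemma Im_sum I (r : seq I) (P : pred I) (F : I -> C) :
  Im (\sum_(i <- r | P i) F i) = \sum_(i <- r | P i) Im (F i).
Proof. by apply: (big_morph _ ImD). Qed.

Lemma ler_normc_sum I (r : seq I) (P : pred I) (F : I -> C) :
  normc (\sum_(i <- r | P i) F i) <= \sum_(i <- r | P i) normc (F i).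
Proof.
elim/big_rec2: _ => [|i a b _ le]; first by rewrite normc0.
by apply: le_trans (le_normcD _ _) _; rewrite lerD2l.
Qed.

(** The norm of [R[i]] has values in [R[i]], so its radii are complex numbers; here they become
    real. *)
Lemma cvg_normcP T (F : set_system T) (FF : Filter F) (f : T -> C) (l : C) :
  (f x @[x --> F] --> l) <->
  (forall e : R, 0 < e -> \forall x \near F, normc (f x - l) <= e).
Proof.
split=> [/cvgrPdistC_le fl e e0|fl].
  have := fl e%:C; rewrite ltcR => /(_ e0).
  by apply: filterS => x h; rewrite -lecR; exact: h.
apply/cvgrPdistC_le => e e0.
have er : e \is Num.real by rewrite realE ltW.
have e0' : 0 < Re e by rewrite -ltcR RRe_real.
apply: filterS (fl _ e0') => x h.
by rewrite normcE -(RRe_real er) lecR.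
Qed.

Lemma cvg_limnC (u : nat -> C) (l : C) : u @ \oo --> l -> limn u = l.
Proof. by move=> h; apply: (cvg_lim _ h); apply: (@norm_hausdorff _ R[i]). Qed.

Lemma cvgC_unique T (F : set_system T) (FF : ProperFilter F) (f : T -> C)
  (l l' : C) : f x @[x --> F] --> l -> f x @[x --> F] --> l' -> l = l'.
Proof.
by move=> h h'; apply: (cvg_unique (@norm_hausdorff _ R[i]) h h').
Qed.

Lemma cvg_ReIm (u : nat -> C) (a b : R) :
  (fun n => Re (u n)) @ \oo --> a -> (fun n => Im (u n)) @ \oo --> b ->
  u @ \oo --> a +i* b.
Proof.
move=> /cvgrPdistC_le ua /cvgrPdistC_le ub; apply/cvg_normcP => e e0.
have e2 : 0 < e / 2 by rewrite divr_gt0.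
apply: filterS2 (ua _ e2) (ub _ e2) => n h1 h2.
apply: le_trans (normc_le_ReIm _) _.
rewrite !ReD !ImD !ReN !ImN /= (splitr e); exact: lerD.
Qed.

Lemma normc_lim_le (u : nat -> C) (l : C) (B : R) :
  u @ \oo --> l -> (forall n, normc (u n) <= B) -> normc l <= B.
Proof.
move=> /cvg_normcP ul uB; apply/ler_addgt0Pr => e e0.
have [n _ /(_ n (leqnn n))] := ul e e0; rewrite normcBC => h.
rewrite -[l](subrK (u n)); apply: le_trans (le_normcD _ _) _.
by rewrite addrC lerD.
Qed.

End Cbasics.

Section RealSeries.
Variable R : realType.
Local Notation C := R[i].

Lemma sum_inv_sqr_le M : \sum_(1 <= n < M) ((n%:R : R) ^+ 2)^-1 <= 2.
Proof.
case: M => [|[|M]]; [by rewrite big_geq|by rewrite big_geq|].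
(* Telescoping: [1 / n ^ 2 <= 1 / (n - 1) - 1 / n]. The subtracted term is what makes the induction
   close. *)
suff : \sum_(1 <= n < M.+2) ((n%:R : R) ^+ 2)^-1 <= 2 - M.+1%:R^-1.
  by move=> h; apply: le_trans h _; rewrite gerBl invr_ge0 ler0n.
elim: M => [|M IH]; first by rewrite big_nat1 expr1n invr1; lra.
rewrite big_nat_recr //=.
apply: le_trans (lerD IH (lexx _)) _.
have a0 : 0 < (M.+1%:R : R) by rewrite ltr0Sn.
have -> : (M.+2%:R : R) = M.+1%:R + 1 by rewrite -natr1.
set a : R := M.+1%:R in a0 *.
rewrite -subr_ge0.
have -> : 2 - (a + 1)^-1 - (2 - a^-1 + ((a + 1) ^+ 2)^-1) =
   (a * (a + 1) ^+ 2)^-1.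
  field.
  by apply/andP; split; lra.
by rewrite invr_ge0 mulr_ge0 ?sqr_ge0 // ltW.
Qed.

Lemma cvg_seriesR (u : nat -> R) (c : R) : (forall n, (0 < n)%N -> `|u n| <= c / n%:R ^+ 2) ->
  exists l : R, (fun M => \sum_(1 <= n < M) u n) @ \oo --> l.
Proof.
move=> uc.
pose v n := if n is 0 then 0 else u n.
have E : (fun M => \sum_(1 <= n < M) u n) = series v.
  apply/funext => -[|M]; first by rewrite seriesEnat /= !big_geq.
  by rewrite seriesEnat /= [RHS]big_ltn //= add0r !big_nat; apply: eq_bigr => -[].
rewrite E.
suff /cvg_ex[l vl] : cvgn (series v) by exists l.
apply: normed_cvg.
change (cvgn (fun M => \sum_(0 <= k < M) `|v k|)).
apply: nondecreasing_is_cvgn.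
  by apply/nondecreasing_seqP => n; rewrite big_nat_recr //= lerDl.
exists (c * 2) => _ [M _ <-].
have c0 : 0 <= c.
  by have := le_trans (normr_ge0 _) (uc 1%N isT); rewrite expr1n divr1.
case: M => [|M]; first by rewrite big_geq // mulr_ge0.
rewrite big_ltn //= normr0 add0r.
apply: le_trans (_ : \sum_(1 <= n < M.+1) c * (n%:R ^+ 2)^-1 <= _).
  rewrite !big_nat; apply: ler_sum => -[//|n _]; exact: uc.
by rewrite -mulr_sumr ler_wpM2l // sum_inv_sqr_le.
Qed.

Lemma cvg_seriesC (u : nat -> C) (c : R) :
  (forall n, (0 < n)%N -> normc (u n) <= c / n%:R ^+ 2) ->
  exists l : C, (fun M => \sum_(1 <= n < M) u n) @ \oo --> l.
Proof.
move=> uc.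
have [|a ha] := @cvg_seriesR (fun n => Re (u n)) c.
  by move=> n n0; apply: le_trans (Re_le_normc _) (uc n n0).
have [|b hb] := @cvg_seriesR (fun n => Im (u n)) c.
  by move=> n n0; apply: le_trans (Im_le_normc _) (uc n n0).
exists (a +i* b); apply: cvg_ReIm.
  by under eq_fun do rewrite Re_sum.
by under eq_fun do rewrite Im_sum.
Qed.

End RealSeries.

(** * The functions phi *)

Section Phi.
Variable R : realType.
Local Notation C := R[i].
Implicit Types (x y z : C) (J : label).

(** Only the translates by [- k0] and [- k0 - 1] can have a real part of modulus below 1, so the
    minimum is over two values and 1. A vanishing translate is excluded, so that the lemma also
    serves at integers. *)
Lemma dist_to_int z : exists d : R,
  [/\ 0 < d, d <= 1 & forall k : int, z + k%:~R != 0 -> d <= normc (z + k%:~R)].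
Proof.
pose g (k : int) : R := if z + k%:~R == 0 then 1 else normc (z + k%:~R).
have g0 k : 0 < g k by rewrite /g; case: eqP => // /eqP; rewrite normc_gt0.
pose k0 := Num.floor (Re z).
exists (Num.min 1 (Num.min (g (- k0)) (g (- k0 - 1)))); split.
- by rewrite !lt_min ltr01 !g0.
- by rewrite ge_min lexx.
move=> k zk; have gk : g k = normc (z + k%:~R) by rewrite /g (negPf zk).
have [lek|/ltW lek|<-] := ltgtP k (- k0).
- have [ltk|ltk|<-] := ltgtP k (- k0 - 1).
  + rewrite ge_min; apply/orP; left.
    apply: le_trans (Re_le_normc _).
    have := floorD1_gt (Re z); rewrite -/k0 => h.
    have : k + k0 <= - 2 by lia.
    rewrite -(ler_int R) rmorphD /= => h2.
    rewrite ReD intC /= ler_normr; apply/orP; right.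
    move: h; rewrite rmorphD /=; lra.
  + by lia.
  + by rewrite -gk !ge_min lexx !orbT.
- case: (eqVneq k (- k0)) => [<-|nk]; first by rewrite -gk !ge_min lexx !orbT.
  rewrite ge_min; apply/orP; left.
  apply: le_trans (Re_le_normc _).
  have := floor_le (Re z); rewrite -/k0 => h.
  have : 1 <= k + k0 by lia.
  rewrite -(ler_int R) rmorphD /= => h2.
  rewrite ReD intC /= ler_normr; apply/orP; left; lra.
- by rewrite -gk !ge_min lexx !orbT.
Qed.

(** For a nonzero translate, [n <= |z + n| + |z| <= |z + n| (1 + |z| / d)]. A zero translate
    satisfies the bound because its inverse is 0. *)
Lemma inv_shift_le z : exists c : R, 0 < c /\ forall n : nat, (0 < n)%N ->
  normc (z + n%:R)^-1 <= c / n%:R /\ normc (z - n%:R)^-1 <= c / n%:R.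
Proof.
have [d [d0 _ hd]] := dist_to_int z.
exists (1 + normc z / d); split; first by rewrite ltr_pwDl // divr_ge0 ?normc_ge0 // ltW.
have key (k : int) (n : nat) : (0 < n)%N -> @normc R k%:~R = n%:R ->
    normc (z + k%:~R)^-1 <= (1 + normc z / d) / n%:R.
  move=> n0 kn; rewrite normcV.
  have [->|zk] := eqVneq (z + k%:~R) 0.
    rewrite normc0 invr0 divr_ge0 // addr_ge0 // divr_ge0 ?normc_ge0 //; exact: ltW.
  have dz := hd _ zk; have a0 : 0 < normc (z + k%:~R) by rewrite normc_gt0.
  rewrite ler_pdivlMr ?ltr0n // mulrC ler_pdivrMr // mulrDl mul1r -kn.
  apply: le_trans (_ : normc (z + k%:~R) + normc z <= _).
    by rewrite -{1}(addKr z (k%:~R)) addrC le_normcB.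
  rewrite lerD2l -mulrA ler_peMr ?normc_ge0 //.
  by rewrite mulrC ler_pdivlMr // mul1r.
by move=> n n0; split; [apply: (key n%:Z)|have := key (- n%:Z) n n0];
  rewrite ?rmorphN /= ?normcN ?normc_nat //; apply.
Qed.

Definition phi_term J N z n : C :=
  (-1) ^+ (n * isII J) * ((z + n%:R) ^- N + (z - n%:R) ^- N).

Lemma normc_sign n : @normc R ((-1) ^+ n) = 1.
Proof. by rewrite normcX normcN normc1 expr1n. Qed.

Lemma inv_shift_expr_le z : exists c : R, 0 < c /\ forall n N : nat, (0 < n)%N ->
  (2 <= N)%N ->
  normc ((z + n%:R) ^- N) <= c ^+ N / n%:R ^+ 2 /\
  normc ((z - n%:R) ^- N) <= c ^+ N / n%:R ^+ 2.
Proof.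
have [c [c0 hc]] := inv_shift_le z; exists c; split=> // n N n0 N2.
have key (y : C) : normc y^-1 <= c / n%:R -> normc (y ^- N) <= c ^+ N / n%:R ^+ 2.
  move=> h; rewrite -(exprVn y) normcX.
  apply: le_trans (_ : (c / n%:R) ^+ N <= _).
    by apply: lerXn2r => //; rewrite nnegrE ?normc_ge0 // divr_ge0 // ltW.
  rewrite exprMn ler_wpM2l ?exprn_ge0 ?(ltW c0) // exprVn.
  rewrite lef_pV2 ?posrE ?exprn_gt0 ?ltr0n //.
  by apply: ler_weXn2l => //; rewrite ler1n.
by have [h1 h2] := hc n n0; split; apply: key.
Qed.

Lemma phi_term_le J N z : (0 < N)%N -> exists c : R, forall n, (0 < n)%N ->
  normc (phi_term J N z n) <= c / n%:R ^+ 2.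
Proof.
case: N => // -[_|N _]; last first.
  have [c [_ hc]] := inv_shift_expr_le z.
  exists (c ^+ N.+2 *+ 2) => n n0.
  rewrite /phi_term normcM normc_sign mul1r.
  have [h1 h2] := hc n N.+2 n0 isT.
  by apply: le_trans (le_normcD _ _) _; rewrite mulr2n mulrDl lerD.
have [c [c0 hc]] := inv_shift_le z.
(* For [N = 1] the terms [n] and [- n] must be paired: their sum is [2 z / ((z + n) (z - n))], which
   gives the first summand. If one of the two denominators is 0, that identity fails, but then
   [n = |z|] and [c / n = |z| c / n ^ 2], covered by the second summand. *)
exists (2 * normc z * c ^+ 2 + 2 * normc z * c) => n n0.
rewrite /phi_term normcM normc_sign mul1r !expr1.
have [h1 h2] := hc n n0.
have nR : 0 < n%:R :> R by rewrite ltr0n.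
have [z1|z1] := eqVneq (z + n%:R) 0; last have [z2|z2] := eqVneq (z - n%:R) 0.
- have nz : n%:R = normc z.
    by move/eqP: z1; rewrite addr_eq0 => /eqP ->; rewrite normcN normc_nat.
  rewrite z1 invr0 add0r; apply: le_trans h2 _; rewrite -{2}nz.
  rewrite mulrDl (_ : 2 * n%:R * c / n%:R ^+ 2 = 2 * (c / n%:R)); last first.
    by field; lra.
  have h : 0 <= c / n%:R by rewrite divr_ge0 // ltW.
  have : 0 <= 2 * normc z * c ^+ 2 / n%:R ^+ 2.
    by rewrite !mulr_ge0 ?invr_ge0 ?exprn_ge0 ?normc_ge0 // ltW.
  lra.
- have nz : n%:R = normc z.
    by move/eqP: z2; rewrite subr_eq0 => /eqP ->; rewrite normc_nat.
  rewrite z2 invr0 addr0; apply: le_trans h1 _; rewrite -{2}nz.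
  rewrite mulrDl (_ : 2 * n%:R * c / n%:R ^+ 2 = 2 * (c / n%:R)); last first.
    by field; lra.
  have h : 0 <= c / n%:R by rewrite divr_ge0 // ltW.
  have : 0 <= 2 * normc z * c ^+ 2 / n%:R ^+ 2.
    by rewrite !mulr_ge0 ?invr_ge0 ?exprn_ge0 ?normc_ge0 // ltW.
  lra.
- have -> : (z + n%:R)^-1 + (z - n%:R)^-1
     = 2 * z * ((z + n%:R)^-1 * (z - n%:R)^-1).
    by field; rewrite z1 z2.
  rewrite !normcM (_ : normc 2 = 2); last by rewrite (normc_nat R 2).
  apply: le_trans (_ : 2 * normc z * (c / n%:R * (c / n%:R)) <= _).
    by rewrite ler_wpM2l ?mulr_ge0 ?normc_ge0 // ler_pM ?normc_ge0.
  rewrite [leRHS]mulrDl (_ : c / n%:R * (c / n%:R) = c ^+ 2 / n%:R ^+ 2); last first.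
    by field; lra.
  by rewrite [leLHS]mulrA lerDl !mulr_ge0 ?invr_ge0 ?exprn_ge0 ?normc_ge0 // ltW.
Qed.

Definition phi_psum J N z M : C :=
  z ^- N + \sum_(1 <= n < M) phi_term J N z n.

Lemma cvg_phi J N z : (0 < N)%N -> phi_psum J N z @ \oo --> phi J N z.
Proof.
move=> N0; have [c hc] := phi_term_le J z N0.
have [l hl] := cvg_seriesC hc.
rewrite /phi (cvg_limnC hl); apply: cvgD hl; exact: cvg_cst.
Qed.

End Phi.

(** [signpow] read on the integer itself, where it is a character with no floor in between. *)
HB.lock Definition int_sign (R : realType) (b : bool) (k : int) : R[i] :=
  (-1) ^ (k * Posz b).

Section PhiProperties.
Variable R : realType.
Local Notation C := R[i].
Local Notation int_sign := (@int_sign R).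
Implicit Types (x y z : C) (J : label).

Lemma cvg_limit_eq T (F : set_system T) (f : T -> C) (l l' : C) :
  l = l' -> f x @[x --> F] --> l -> f x @[x --> F] --> l'.
Proof. by move=> ->. Qed.

Lemma cvgC_eq (u v : nat -> C) (l l' : C) :
  u @ \oo --> l -> v @ \oo --> l' -> (forall n, u n = v n) -> l = l'.
Proof. by move=> ul vl /funext uv; apply: (cvgC_unique _ ul); rewrite uv. Qed.

Lemma cvgZC T (F : set_system T) {FF : Filter F} (f : T -> C) (c l : C) :
  f x @[x --> F] --> l -> c * f x @[x --> F] --> c * l.
Proof. by move=> fl; exact: (cvgM (cvg_cst c) fl). Qed.

Lemma cvg_seqZC (u : nat -> C) (c l : C) :
  u @ \oo --> l -> (fun n => c * u n) @ \oo --> c * l.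
Proof. exact: cvgZC. Qed.

Lemma cvg_subseqC (u : nat -> C) (l : C) (f : nat -> nat) :
  (forall n, (n <= f n)%N) -> u @ \oo --> l -> (fun n => u (f n)) @ \oo --> l.
Proof.
move=> nf /cvg_normcP ul; apply/cvg_normcP => e e0.
have [n _ hn] := ul e e0; exists n => // k /= nk.
by apply: hn => /=; apply: leq_trans nk _.
Qed.

Lemma cvg_inv_shift z N : (0 < N)%N ->
  ((fun n => (z + n%:R) ^- N) @ \oo --> (0 : C)) /\
  ((fun n => (z - n%:R) ^- N) @ \oo --> (0 : C)).
Proof.
move=> N0; have [c [c0 hc]] := inv_shift_le z.
have key (f : nat -> C) : (forall n, (0 < n)%N -> normc (f n)^-1 <= c / n%:R) ->
    (fun n => f n ^- N) @ \oo --> (0 : C).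
  move=> hf; have h : (fun n => (f n)^-1) @ \oo --> (0 : C).
    apply/cvg_normcP => e e0.
    exists (Num.trunc (c / e)).+1 => // n /= hn; rewrite subr0.
    have n0 : (0 < n)%N by apply: leq_trans hn.
    apply: le_trans (hf _ n0) _.
    rewrite ler_pdivrMr ?ltr0n // mulrC -ler_pdivrMr //.
    apply: le_trans (_ : (Num.trunc (c / e)).+1%:R <= _); last by rewrite ler_nat.
    by apply: ltW; apply: truncnS_gt.
  case: N N0 => // N _.
  elim: N => [|N IH]; first by under eq_fun do rewrite expr1.
  under eq_fun do rewrite exprS invfM.
  by apply: (cvg_limit_eq (mulr0 0)); apply: cvgM.
by split; apply: key => n n0; have [] := hc n n0.
Qed.

Lemma phi_psumS J N z M :
  phi_psum J N z M.+2 = phi_psum J N z M.+1 + phi_term J N z M.+1.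
Proof. by rewrite /phi_psum big_nat_recr //= addrA. Qed.

(** The shift by 1 moves the symmetric window of summation by one place; the two end terms that do
    not match tend to 0. *)
Lemma phi_psum_shift J N z M :
  phi_psum J N (z + 1) M.+1 = (-1) ^+ isII J * phi_psum J N z M.+1
   + ((-1) ^+ (M * isII J) * (z + M.+1%:R) ^- N
      - (-1) ^+ (M.+1 * isII J) * (z - M%:R) ^- N).
Proof.
elim: M => [|M IH].
  by rewrite /phi_psum !big_geq // mul1n mul0n subr0 expr0 mul1r !addr0 addrCA subrr addr0.
rewrite !phi_psumS IH.
rewrite /phi_term {IH}.
have -> : z + 1 + M.+1%:R = z + M.+2%:R by rewrite -[M.+2%:R]natr1; ring.
have -> : z + 1 - M.+1%:R = z - M%:R by rewrite -[M.+1%:R]natr1; ring.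
case: J; rewrite /= ?muln0 ?muln1 ?exprS; ring.
Qed.

Lemma phi_shift1 J N z : (0 < N)%N ->
  phi J N (z + 1) = (-1) ^+ isII J * phi J N z.
Proof.
move=> N0; have [h1 h2] := cvg_inv_shift z N0.
have sgn0 (f : nat -> nat) (g : nat -> C) : g @ \oo --> (0 : C) ->
    (fun n => (-1) ^+ (f n) * g n) @ \oo --> (0 : C).
  move=> /cvg_normcP hg; apply/cvg_normcP => e /hg.
  by apply: filterS => n; rewrite !subr0 normcM normc_sign mul1r.
have H1 := sgn0 (fun M => M * isII J)%N _ (cvg_subseqC leqnSn h1).
have H2 := sgn0 (fun M => M.+1 * isII J)%N _ h2.
have H3 := cvg_seqZC (c := (-1) ^+ isII J) (cvg_subseqC leqnSn (@cvg_phi R J N z N0)).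
have H4 := cvg_subseqC leqnSn (@cvg_phi R J N (z + 1) N0).
rewrite (cvgC_eq H4 (cvgD H3 (cvgB H1 H2)) (phi_psum_shift J N z)).
by rewrite subrr addr0.
Qed.

Lemma int_signD b k l : int_sign b (k + l) = int_sign b k * int_sign b l.
Proof. by rewrite int_sign.unlock mulrDl expfzDr // oppr_eq0 oner_eq0. Qed.

Lemma int_sign0 b : int_sign b 0 = 1.
Proof. by rewrite int_sign.unlock mul0r expr0z. Qed.

Lemma int_sign1 b : int_sign b 1 = (-1) ^+ b.
Proof. by rewrite int_sign.unlock mul1r. Qed.

Lemma int_signK b k : int_sign b k * int_sign b k = 1.
Proof.
by rewrite int_sign.unlock -expfzMl mulrNN mul1r exp1rz.
Qed.

Lemma signpow_int b k : signpow b (k%:~R : C) = int_sign b k.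
Proof. by rewrite int_sign.unlock /signpow intC /= intrKfloor. Qed.

Lemma phi_shift J N z (k : int) : (0 < N)%N ->
  phi J N (z + k%:~R) = int_sign (isII J) k * phi J N z.
Proof.
move=> N0; elim/int_rect: k z => [|n IH|n IH] z.
- by rewrite addr0 int_sign0 mul1r.
- have -> : n.+1%:Z%:~R = n%:Z%:~R + 1 :> C by rewrite -addn1 PoszD intrD.
  rewrite addrA (phi_shift1 J _ N0) IH.
  by rewrite -(int_sign1 (isII J)) mulrA -int_signD -PoszD add1n.
- have := phi_shift1 J (z + (- n.+1%:Z)%:~R) N0.
  have -> : z + (- n.+1%:Z)%:~R + 1 = z + (- n%:Z)%:~R.
    by rewrite -addrA; congr (_ + _); rewrite -addn1 PoszD opprD intrD subrK.
  rewrite -(int_sign1 (isII J)); move: (phi J N (z + (- n.+1%:Z)%:~R)) => y E.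
  have -> : y = int_sign (isII J) 1 * (int_sign (isII J) 1 * y).
    by rewrite mulrA int_signK mul1r.
  rewrite -E IH (_ : - n%:Z = 1 - n.+1%:Z); last by lia.
  by rewrite int_signD !mulrA int_signK mul1r.
Qed.

Lemma phi_parity J N z : (0 < N)%N -> phi J N (- z) = (-1) ^+ N * phi J N z.
Proof.
move=> N0.
apply: (cvgC_eq (@cvg_phi R J N (- z) N0) (cvg_seqZC (@cvg_phi R J N z N0))) => M.
have key (y : C) : (- y) ^- N = (-1) ^+ N * y ^- N.
  by rewrite (exprNn y) invfM -(exprVn (-1)) invrN invr1.
rewrite /phi_psum mulrDr key; congr (_ + _).
rewrite mulr_sumr; apply: eq_bigr => n _; rewrite /phi_term mulrCA; congr (_ * _).
have -> : - z + n%:R = - (z - n%:R) by ring.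
have -> : - z - n%:R = - (z + n%:R) by ring.
by rewrite !key -mulrDr addrC.
Qed.

(** In the sum of the series [I] and [II] the odd terms cancel and the even ones double, leaving the
    series [I] at [z / 2]. This reduces both the value at 0 and the decay of [phi II] to those of
    [phi I]. *)
Lemma phi_duplication N z : (0 < N)%N ->
  phi II N z = 2 * 2 ^- N * phi I N (z / 2) - phi I N z.
Proof.
move=> N0; apply/eqP; rewrite eq_sym subr_eq eq_sym addrC; apply/eqP.
have lef n : (n <= n.*2.+1)%N by lia.
have h1 := cvg_subseqC lef (@cvg_phi R I N z N0).
have h2 := cvg_subseqC lef (@cvg_phi R II N z N0).
have h3 := cvg_subseqC leqnSn (@cvg_phi R I N (z / 2) N0).
apply: (cvgC_eq (cvgD h1 h2) (cvg_seqZC h3)) => n.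
rewrite -[LHS]/(phi_psum I N z n.*2.+1 + phi_psum II N z n.*2.+1).
have key (y : C) : (y * 2) ^- N = 2 ^- N * y ^- N.
  by rewrite exprMn invfM mulrC.
have two0 : (2 : C) != 0 by rewrite pnatr_eq0.
elim: n => [|n IH].
  rewrite /phi_psum !big_geq // !addr0 -mulrA -key divfK //. by rewrite mulr_natl mulr2n.
rewrite doubleS !phi_psumS [RHS]mulrDr -IH /phi_term.
rewrite !muln0 !muln1 !expr0 !mul1r.
rewrite -[(-1) ^+ n.*2.+2]signr_odd -[(-1) ^+ n.*2.+1]signr_odd /= odd_double.
rewrite /= expr0 expr1 -mulrA [2 ^- N * _]mulrDr -!key.
have -> : (z / 2 + n.+1%:R) * 2 = z + n.*2.+2%:R.
  by rewrite mulrDl divfK // -natrM muln2.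
have -> : (z / 2 - n.+1%:R) * 2 = z - n.*2.+2%:R.
  by rewrite mulrBl divfK // -natrM muln2.
ring.
Qed.

(** The singular term [0 ^- N] is 0 by convention, and for even [N] the terms [n] and [- n]
    coincide. *)
Lemma phi_I0 N : (0 < N)%N -> ~~ odd N -> phi I N (0 : C) = (2 * zeta R N)%:C.
Proof.
move=> N0 oN; have N2 : (2 <= N)%N by case: N N0 oN => [|[|n]].
have [l hl] : exists l : R, (fun M => \sum_(1 <= n < M) (n%:R : R) ^- N) @ \oo --> l.
  apply: (@cvg_seriesR _ _ 1) => n n0; rewrite mul1r ger0_norm ?invr_ge0 ?exprn_ge0 //.
  rewrite lef_pV2 ?posrE ?exprn_gt0 ?ltr0n //.
  by apply: ler_weXn2l => //; rewrite ler1n.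
have -> : zeta R N = l by apply: (cvg_lim _ hl).
have E M : phi_psum I N 0 M = (2 * \sum_(1 <= n < M) (n%:R : R) ^- N)%:C.
  rewrite /phi_psum expr0n gtn_eqF //= invr0 add0r mulr_sumr rmorph_sum /=.
  apply: eq_bigr => n _; rewrite /phi_term muln0 mul1r add0r sub0r.
  rewrite exprNn -signr_odd (negPf oN) expr0 !mul1r -mulr2n -[LHS]mulr_natl.
  by rewrite rmorphM /= fmorphV rmorphXn /= !natC.
apply: (cvgC_eq (@cvg_phi R I N 0 N0) _ E); apply/cvg_normcP => e e0.
have e2 : 0 < e / 2 by rewrite divr_gt0.
move/cvgrPdistC_le/(_ _ e2): hl; apply: filterS => M h.
rewrite -(rmorphB (real_complex R)) normc_real -mulrBr normrM ger0_norm //.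
by rewrite mulrC -ler_pdivlMr.
Qed.

Lemma phi0 J N : (0 < N)%N -> phi J N (0 : C) = alpha R J N.
Proof.
move=> N0; rewrite /alpha; case: ifPn => oN.
  have := phi_parity J 0 N0; rewrite oppr0 -signr_odd oN mulN1r => /eqP.
  rewrite -addr_eq0 -mulr2n -mulr_natl mulf_eq0 pnatr_eq0 /=.
  by move/eqP.
case: J; rewrite ?phi_duplication // ?mul0r ?phi_I0 //.
rewrite (_ : 2 * 2 ^- N = 2 ^ (1 - N%:Z)); last first.
  by rewrite expfzDr ?pnatr_eq0 // expr1z exprnN.
have -> : (2 : C) ^ (1 - N%:Z) = ((2 : R) ^ (1 - N%:Z))%:C.
  by rewrite (fmorphXz (real_complex R)) rmorph_nat.
rewrite -(rmorphM (real_complex R)) -(rmorphB (real_complex R)); congr (_%:C).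
by ring.
Qed.

End PhiProperties.

(** * Finite Taylor expansions *)

Section Jets.
Variable R : realType.
Local Notation C := R[i].
Implicit Types (g : C -> C) (p q : {poly C}).

(** A Taylor expansion to order [K], in which the coefficients of [p] from degree [K] on carry no
    information. The point [t = 0] is left out since [g] may take a default value there. *)
Definition jet g p (K : nat) : Prop := exists B d : R,
  [/\ 0 <= B, 0 < d & forall t, t != 0 -> normc t < d ->
    normc (g t - p.[t]) <= B * normc t ^+ K].

Lemma normc_horner_le p : exists B : R, 0 <= B /\
  forall t, normc t <= 1 -> normc p.[t] <= B.
Proof.
exists (\sum_(i < size p) normc p`_i); split.
  by apply: sumr_ge0 => i _; apply: normc_ge0.
move=> t t1; rewrite horner_coef; apply: le_trans (ler_normc_sum _ _ _) _.
apply: ler_sum => i _; rewrite normcM normcX ler_piMr ?normc_ge0 //.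
by rewrite exprn_ile1 ?normc_ge0.
Qed.

Lemma jet_eq g g' p K (d : R) : 0 < d ->
  (forall t, t != 0 -> normc t < d -> g t = g' t) -> jet g p K -> jet g' p K.
Proof.
move=> d0 gg' [B [e [B0 e0 h]]]; exists B, (Num.min d e); split=> //.
  by rewrite lt_min d0.
by move=> t t0; rewrite lt_min => /andP[td te]; rewrite -gg' // h.
Qed.

Lemma jet_horner p K : jet (fun t => p.[t]) p K.
Proof.
by exists 0, 1; split=> // t _ _; rewrite subrr normc0 mul0r.
Qed.

Lemma jet_weaken g p K L : (L <= K)%N -> jet g p K -> jet g p L.
Proof.
move=> LK [B [d [B0 d0 h]]]; exists B, (Num.min d 1); split=> //.
  by rewrite lt_min d0 ltr01.
move=> t t0; rewrite lt_min => /andP[td t1]; apply: le_trans (h _ t0 td) _.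
by rewrite ler_wpM2l // ler_wiXn2l ?normc_ge0 // ltW.
Qed.

Lemma jetD g1 g2 p1 p2 K :
  jet g1 p1 K -> jet g2 p2 K -> jet (fun t => g1 t + g2 t) (p1 + p2) K.
Proof.
move=> [B1 [d1 [B10 d10 h1]]] [B2 [d2 [B20 d20 h2]]].
exists (B1 + B2), (Num.min d1 d2); split; rewrite ?addr_ge0 ?lt_min ?d10 //.
move=> t t0; rewrite lt_min => /andP[t1 t2].
rewrite hornerD opprD addrACA; apply: le_trans (le_normcD _ _) _.
by rewrite mulrDl lerD ?h1 ?h2.
Qed.

Lemma jetM g1 g2 p1 p2 K :
  jet g1 p1 K -> jet g2 p2 K -> jet (fun t => g1 t * g2 t) (p1 * p2) K.
Proof.
move=> [B1 [d1 [B10 d10 h1]]] [B2 [d2 [B20 d20 h2]]].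
have [A1 [A10 a1]] := normc_horner_le p1.
have [A2 [A20 a2]] := normc_horner_le p2.
exists ((A1 + B1) * B2 + B1 * A2), (Num.min 1 (Num.min d1 d2)); split.
- by rewrite !(addr_ge0, mulr_ge0).
- by rewrite !lt_min ltr01 d10.
move=> t t0; rewrite !lt_min => /and3P[/ltW t1 td1 td2].
have {}h1 := h1 t t0 td1; have {}h2 := h2 t t0 td2.
have -> : g1 t * g2 t - (p1 * p2).[t]
   = g1 t * (g2 t - p2.[t]) + (g1 t - p1.[t]) * p2.[t].
  by rewrite hornerM; ring.
apply: le_trans (le_normcD _ _) _; rewrite !normcM mulrDl -mulrA.
apply: lerD.
  apply: ler_pM; rewrite ?normc_ge0 //.
  rewrite -[g1 t](subrK p1.[t]) addrC; apply: le_trans (le_normcD _ _) _.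
  rewrite lerD ?a1 //; apply: le_trans h1 _.
  by rewrite ler_piMr // exprn_ile1 ?normc_ge0.
by rewrite mulrAC; apply: ler_pM; rewrite ?normc_ge0 // a2.
Qed.

Lemma jet_const (c : C) K : jet (fun=> c) c%:P K.
Proof.
by apply: (jet_eq ltr01 _ (jet_horner c%:P K)) => t _ _; rewrite hornerC.
Qed.

Lemma jet_expr n K : jet (fun t => t ^+ n) 'X^n K.
Proof.
by apply: (jet_eq ltr01 _ (jet_horner 'X^n K)) => t _ _; rewrite hornerXn.
Qed.

Lemma jetZ (c : C) g p K : jet g p K -> jet (fun t => c * g t) (c *: p) K.
Proof. by move=> h; rewrite -mul_polyC; apply: jetM (jet_const _ _) h. Qed.

Lemma jetB g1 g2 p1 p2 K :
  jet g1 p1 K -> jet g2 p2 K -> jet (fun t => g1 t - g2 t) (p1 - p2) K.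
Proof.
move=> h1 /(jetZ (-1)) h2.
apply: (jet_eq ltr01 _ _); last by rewrite -scaleN1r; apply: jetD h1 h2.
by move=> t _ _ /=; rewrite mulN1r.
Qed.

Lemma jet_sum (I : Type) (r : seq I) (P : pred I) (G : I -> C -> C) (F : I -> {poly C}) K :
  (forall i, P i -> jet (G i) (F i) K) ->
  jet (fun t => \sum_(i <- r | P i) G i t) (\sum_(i <- r | P i) F i) K.
Proof.
move=> h; elim: r => [|i r IH].
  rewrite big_nil; apply: (jet_eq ltr01 _ (jet_const 0 K)).
  by move=> t _ _; rewrite big_nil.
rewrite big_cons; case: ifPn => Pi; last first.
  by apply: (jet_eq ltr01 _ IH) => t _ _; rewrite big_cons (negPf Pi).
apply: (jet_eq ltr01 _ (jetD (h _ Pi) IH)) => t _ _.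
by rewrite big_cons Pi.
Qed.

Lemma jet_prod (I : Type) (r : seq I) (P : pred I) (G : I -> C -> C) (F : I -> {poly C}) K :
  (forall i, P i -> jet (G i) (F i) K) ->
  jet (fun t => \prod_(i <- r | P i) G i t) (\prod_(i <- r | P i) F i) K.
Proof.
move=> h; elim: r => [|i r IH].
  rewrite big_nil; apply: (jet_eq ltr01 _ (jet_const 1 K)).
  by move=> t _ _; rewrite big_nil.
rewrite big_cons; case: ifPn => Pi; last first.
  by apply: (jet_eq ltr01 _ IH) => t _ _; rewrite big_cons (negPf Pi).
apply: (jet_eq ltr01 _ (jetM (h _ Pi) IH)) => t _ _.
by rewrite big_cons Pi.
Qed.

(** This is how removable singularities are removed: once the coefficients below [M] are known to
    vanish, the factor [t ^ M] is cancelled away from 0. *)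
Lemma jet_divX g p M K :
  jet (fun t => t ^+ M * g t) ('X^M * p) (M + K) -> jet g p K.
Proof.
move=> [B [d [B0 d0 h]]]; exists B, d; split=> // t t0 td.
have := h t t0 td; rewrite hornerM hornerXn -mulrBr normcM normcX exprD.
rewrite mulrCA ler_pM2l //; by rewrite exprn_gt0 // normc_gt0.
Qed.

Lemma jet_coef0 p K : jet (fun=> 0) p K.+1 -> p`_0 = 0.
Proof.
move=> [B [d [B0 d0 h]]].
have [q pq] : exists q, p = q * 'X + (p`_0)%:P.
  exists (\poly_(i < size p) p`_i.+1); apply/polyP => i.
  rewrite coefD coefMX coefC; case: i => [|i]; rewrite ?add0r ?addr0 //=.
  rewrite coef_poly; case: ltnP => // hi.
  by rewrite nth_default // ltnW.
have [A [A0 a]] := normc_horner_le q.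
apply/eqP; rewrite -normc_eq0; apply/eqP/le_anti; rewrite normc_ge0 andbT.
apply/ler_addgt0Pr => e e0; rewrite add0r.
(* A test point inside the radius [d] and at most 1, at which both the error, at most [B t], and the
   rest of [p], at most [A t], stay below [e] together. *)
pose t : R := Num.min (Num.min (d / 2) 1) (e / (A + B + 1)).
have D0 : 0 < A + B + 1 by rewrite ltr_wpDl // addr_ge0.
have t0 : 0 < t by rewrite !lt_min !divr_gt0 ?ltr01.
have tt : normc t%:C = t by rewrite normc_real gtr0_norm.
have t1 : t <= 1 by rewrite !ge_min lexx orbT.
have td : t < d.
  apply: le_lt_trans (_ : d / 2 < _); first by rewrite !ge_min lexx.
  by rewrite ltr_pdivrMr // mulr_natr mulr2n ltrDl.
have te : t * (A + B + 1) <= e by rewrite -ler_pdivlMr // ge_min lexx orbT.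
have tC : t%:C != 0 by rewrite -normc_gt0 tt.
have := h t%:C tC; rewrite tt sub0r normcN => /(_ td).
rewrite {1}pq hornerD hornerMX hornerC => {}h.
have {}a : normc (q.[t%:C] * t%:C) <= A * t.
  by rewrite normcM tt ler_wpM2r ?(ltW t0) // a // tt.
have h2 : B * t ^+ K.+1 <= B * t.
  by rewrite ler_wpM2l // exprS ler_piMr ?(ltW t0) // exprn_ile1 // ltW.
have := le_normcB (q.[t%:C] * t%:C + p`_0) (q.[t%:C] * t%:C).
rewrite [X in normc X <= _](_ : _ = p`_0); last by rewrite addrAC subrr add0r.
by nra.
Qed.
(** The constant term vanishes, so one factor ['X] splits off and the order drops by one. *)
Lemma jet_coef p K i : jet (fun=> 0) p K -> (i < K)%N -> p`_i = 0.
Proof.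
elim: K p i => [//|K IH] p i pK iK.
have p0 := jet_coef0 pK.
case: i iK => [_|i iK]; first exact: p0.
have pq : p = 'X^1 * drop_poly 1 p.
  apply/polyP => -[|k]; rewrite coefXnM ?p0 //= subn1 coef_drop_poly addn1 //.
rewrite -addn1 -coef_drop_poly; apply: IH => //.
apply: (@jet_divX _ _ 1); rewrite -pq.
by apply: (jet_eq ltr01 _ pK) => t _ _; rewrite mulr0.
Qed.

Lemma jet_unique g p q K i : jet g p K -> jet g q K -> (i < K)%N -> p`_i = q`_i.
Proof.
move=> gp gq iK; apply/eqP; rewrite -subr_eq0 -coefB; apply/eqP.
apply: (@jet_coef _ K) => //.
by apply: (jet_eq ltr01 _ (jetB gp gq)) => t _ _; rewrite subrr.
Qed.

Lemma jet_trunc g p q K :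
  (forall i, (i < K)%N -> p`_i = q`_i) -> jet g p K -> jet g q K.
Proof.
move=> pq gp.
have -> : q = p + 'X^K * drop_poly K (q - p).
  apply/polyP => i; rewrite coefD coefXnM; case: ltnP => iK.
    by rewrite addr0 pq.
  by rewrite coef_drop_poly subnK // coefB addrC subrK.
suff h : jet (fun=> 0) ('X^K * drop_poly K (q - p)) K.
  by apply: (jet_eq ltr01 _ (jetD gp h)) => t _ _; rewrite addr0.
have [A [A0 a]] := normc_horner_le (drop_poly K (q - p)).
exists A, 1; split=> // t _ /ltW t1.
rewrite sub0r normcN hornerM hornerXn normcM normcX mulrC ler_wpM2r //.
  by rewrite exprn_ge0 // normc_ge0.
exact: a.
Qed.

Lemma jet_scale (a : C) g p K :
  a != 0 -> jet g p K -> jet (fun t => g (a * t)) (p \Po (a *: 'X)) K.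
Proof.
move=> a0 [B [d [B0 d0 h]]].
have na : 0 < normc a by rewrite normc_gt0.
exists (B * normc a ^+ K), (d / normc a); split; rewrite ?divr_gt0 //.
  by rewrite mulr_ge0 // exprn_ge0 // normc_ge0.
move=> t t0 td; rewrite horner_comp hornerZ hornerX -mulrA -exprMn -normcM.
apply: h; first by rewrite mulf_neq0.
by rewrite normcM mulrC -ltr_pdivlMr.
Qed.

End Jets.

(** * Laurent expansions of phi *)

(** The generalised binomial coefficient of [- N] over [v], that is, the coefficient of [q ^ v] in
    [(1 + q) ^- N]. *)
Definition neg_binom (R : realType) N v : R[i] := (-1) ^+ v * 'C((N + v).-1, v)%:R.

(** The coefficient of [t ^ v] in the regular part of [phi J N (x + t)], obtained by expanding the
    series term by term. *)
HB.lock Definition phi_coef (R : realType) J N (x : R[i]) v : R[i] :=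
  neg_binom R N v * phi J (N + v) x.

Section PhiExpansion.
Variable R : realType.
Local Notation C := R[i].
Implicit Types (x y z t q : C) (J : label).
Local Notation neg_binom := (neg_binom R).

Lemma cvg_sumC T (F : set_system T) (FF : Filter F) (I : Type) (r : seq I)
    (P : pred I) (f : I -> T -> C) (l : I -> C) :
  (forall i, P i -> f i x @[x --> F] --> l i) ->
  \sum_(i <- r | P i) f i x @[x --> F] --> \sum_(i <- r | P i) l i.
Proof.
move=> fl; elim: r => [|i r IH].
  by under eq_fun do rewrite big_nil; rewrite big_nil; exact: cvg_cst.
under eq_fun do rewrite big_cons; rewrite big_cons.
case: ifPn => [Pi|_]; [exact: (cvgD (fl i Pi) IH)|exact: IH].
Qed.

Lemma cvg_prodC T (F : set_system T) {FF : Filter F} (I : Type) (u : seq I)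
    (f : I -> T -> C) (l : I -> C) :
  (forall i, f i x @[x --> F] --> l i) ->
  \prod_(i <- u) f i x @[x --> F] --> \prod_(i <- u) l i.
Proof.
move=> fl; elim: u => [|i u IH].
  by under eq_fun do rewrite big_nil; rewrite big_nil; exact: cvg_cst.
under eq_fun do rewrite big_cons; rewrite big_cons.
exact: (cvgM (fl i) IH).
Qed.

(** Pascal's rule: multiplication by [1 + q] lowers the exponent by one, and truncation leaves one
    boundary term. *)
Lemma neg_binom_rec N K q :
  (1 + q) * \sum_(v < K.+1) neg_binom N.+1 v * q ^+ v =
  \sum_(v < K.+1) neg_binom N v * q ^+ v + (-1) ^+ K * 'C(N + K, K)%:R * q ^+ K.+1.
Proof.
elim: K => [|K IH].
  by rewrite !big_ord_recr !big_ord0 /neg_binom /= !addn0 !bin0; ring.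
rewrite big_ord_recr /= [in RHS]big_ord_recr /= mulrDr IH /neg_binom.
rewrite addSn /= addnS /= binS natrD !exprS; ring.
Qed.

Lemma neg_binom_rem N K : exists A : R, 0 <= A /\ forall q, normc q <= 1 / 2 ->
  normc ((1 + q) ^- N - \sum_(v < K.+1) neg_binom N v * q ^+ v)
    <= A * normc q ^+ K.+1.
Proof.
elim: N => [|N [A [A0 hA]]].
  exists 0; split=> // q _; rewrite expr0 invr1 big_ord_recl big1.
    by rewrite /neg_binom !expr0 bin0 !mulr1 addr0 subrr normc0 mul0r.
  by move=> i _; rewrite /neg_binom /= bin_small ?mulr0 ?mul0r //.
(* The factor 2 bounds the inverse of [1 + q] for [|q| <= 1 / 2]; the other summand is the boundary
   term of [neg_binom_rec]. *)
exists (2 * (A + 'C(N + K, K)%:R)); split.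
  by rewrite mulr_ge0 // addr_ge0.
move=> q hq; have q1 : 1 + q != 0.
  rewrite -normc_gt0.
  have := ler_distc 1 (- q); rewrite opprK normcN normc1; lra.
have E : (1 + q) ^- N.+1 - \sum_(v < K.+1) neg_binom N.+1 v * q ^+ v =
   (1 + q)^-1 * ((1 + q) ^- N - \sum_(v < K.+1) neg_binom N v * q ^+ v
     - (-1) ^+ K * 'C(N + K, K)%:R * q ^+ K.+1).
  apply: (mulfI q1); rewrite mulrBr neg_binom_rec mulrA divff // mul1r.
  by rewrite exprS invfM mulrA divff // mul1r; ring.
rewrite E normcM -[leRHS]mulrA; apply: ler_pM; rewrite ?normc_ge0 //.
  rewrite normcV invf_ple ?posrE ?normc_gt0 //.
  have := ler_distc 1 (- q); rewrite opprK normcN normc1; lra.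
apply: le_trans (le_normcB _ _) _; rewrite mulrDl lerD ?hA //.
by rewrite !normcM normc_sign normc_nat mul1r normcX.
Qed.

(** The Taylor remainder of [(y + t) ^- N]. At [y = 0] the whole function is polar and is subtracted
    as such, while the Taylor terms are 0 by the convention on inverses. *)
Definition power_rem N K t y : C :=
  (y + t) ^- N - (y == 0)%:R * t ^- N
   - \sum_(v < K.+1) neg_binom N v * t ^+ v * y ^- (N + v).

Lemma power_rem0 N K t : (0 < N)%N -> power_rem N K t 0 = 0.
Proof.
move=> N0; rewrite /power_rem add0r eqxx mul1r subrr sub0r big1 ?oppr0 // => v _.
by rewrite expr0n addn_eq0 gtn_eqF //= invr0 mulr0.
Qed.

(** Substitute [q = t / y] in [neg_binom_rem]. For positive [N] the power of [y] in the bound has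
    exponent at least 2, so the remainders at all integer translates are summable, even for
    [N = 1]. *)
Lemma power_rem_le N K : exists A : R, 0 <= A /\ forall t y, y != 0 ->
  normc t <= normc y / 2 ->
  normc (power_rem N K t y) <= A * normc t ^+ K.+1 * normc (y ^- (N + K.+1)).
Proof.
have [A [A0 hA]] := neg_binom_rem N K; exists A; split=> // t y y0 ty.
have ny : 0 < normc y by rewrite normc_gt0.
have -> : power_rem N K t y = y ^- N * ((1 + t / y) ^- N
   - \sum_(v < K.+1) neg_binom N v * (t / y) ^+ v).
  rewrite /power_rem (negPf y0) mul0r subr0 mulrBr; congr (_ - _).
    by rewrite -invfM -exprMn mulrDr mulr1 mulrCA divff // mulr1.
  rewrite mulr_sumr; apply: eq_bigr => v _.
  by rewrite exprD invfM expr_div_n; move: (y ^- N) (y ^- v) => b1 b2; ring.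
have {}hA := hA (t / y); rewrite normcM exprD invfM mulrC.
have -> : A * normc t ^+ K.+1 * normc (y ^- N / y ^+ K.+1)
   = A * normc (t / y) ^+ K.+1 * normc (y ^- N).
  by rewrite !normcM exprMn -(exprVn y K.+1) normcX; ring.
apply: ler_wpM2r; first exact: normc_ge0.
apply: hA; rewrite normcM normcV ler_pdivrMr //; lra.
Qed.

(** An exact identity between partial sums, so that a bound uniform in [M] passes to the limit. The
    hypothesis says that only the central term may be singular: [x] is 0 or not an integer. *)
Lemma phi_psum_rem J N K x t M : (forall n, (0 < n)%N -> x + n%:R != 0 /\ x - n%:R != 0) ->
  phi_psum J N (x + t) M - (x == 0)%:R * t ^- N
   - \sum_(v < K.+1) neg_binom N v * t ^+ v * phi_psum J (N + v) x M =
  power_rem N K t x + \sum_(1 <= n < M) (-1) ^+ (n * isII J) *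
    (power_rem N K t (x + n%:R) + power_rem N K t (x - n%:R)).
Proof.
move=> hx; have base : \sum_(v < K.+1) neg_binom N v * t ^+ v * phi_psum J (N + v) x 1 =
   \sum_(v < K.+1) neg_binom N v * t ^+ v * x ^- (N + v).
  by apply: eq_bigr => v _; rewrite /phi_psum big_geq // addr0.
have psum1 L y : phi_psum J L y 1 = y ^- L.
  by rewrite /phi_psum big_geq // addr0.
have psum0 L y : phi_psum J L y 0 = phi_psum J L y 1.
  by rewrite psum1 /phi_psum big_geq // addr0.
have base1 : phi_psum J N (x + t) 1 - (x == 0)%:R * t ^- N
   - \sum_(v < K.+1) neg_binom N v * t ^+ v * phi_psum J (N + v) x 1 =
  power_rem N K t x.
  by rewrite base psum1.
case: M => [|M].
  rewrite [in RHS]big_geq // addr0 psum0 -base1; congr (_ - _).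
elim: M => [|M IH].
  by rewrite [in RHS]big_geq // addr0 base1.
rewrite big_nat_recr //= addrA -IH.
have -> : \sum_(v < K.+1) neg_binom N v * t ^+ v * phi_psum J (N + v) x M.+2 =
  \sum_(v < K.+1) neg_binom N v * t ^+ v * phi_psum J (N + v) x M.+1 +
  \sum_(v < K.+1) neg_binom N v * t ^+ v * phi_term J (N + v) x M.+1.
  by rewrite -big_split /=; apply: eq_bigr => v _; rewrite phi_psumS mulrDr.
have -> : \sum_(v < K.+1) neg_binom N v * t ^+ v * phi_term J (N + v) x M.+1 =
  (-1) ^+ (M.+1 * isII J) *
   (\sum_(v < K.+1) neg_binom N v * t ^+ v * (x + M.+1%:R) ^- (N + v) +
    \sum_(v < K.+1) neg_binom N v * t ^+ v * (x - M.+1%:R) ^- (N + v)).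
  rewrite -big_split mulr_sumr /=; apply: eq_bigr => v _.
  by rewrite /phi_term; ring.
have [x1 x2] := hx M.+1 isT.
rewrite phi_psumS /power_rem (negPf x1) (negPf x2) !mul0r !subr0 /phi_term.
have -> : x + t + M.+1%:R = x + M.+1%:R + t by ring.
have -> : x + t - M.+1%:R = x - M.+1%:R + t by ring.
set S1 := \sum_(v < K.+1) _; set S2 := \sum_(v < K.+1) _; set S3 := \sum_(v < K.+1) _.
ring.
Qed.

Lemma phi_jet_nonzero J N x K : (0 < N)%N ->
  (forall n, (0 < n)%N -> x + n%:R != 0 /\ x - n%:R != 0) ->
  jet (fun t => t ^+ N * phi J N (x + t))
    ((x == 0)%:R%:P + 'X^N * \poly_(v < K.+1) phi_coef J N x v) (N + K.+1).
Proof.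
move=> N0 hx.
have [d [d0 _ hd]] := dist_to_int x.
have [A [A0 hA]] := power_rem_le N K.
have [c [c0 hc]] := inv_shift_expr_le x.
(* The first summand is for the central term; the 4 is two translates for each [n], times the bound
   2 on the sum of the [1 / n ^ 2]. *)
pose B := A * (normc (x ^- (N + K.+1)) + 4 * c ^+ (N + K.+1)).
have B0 : 0 <= B.
  by rewrite mulr_ge0 // addr_ge0 ?normc_ge0 // mulr_ge0 // exprn_ge0 // ltW.
(* Half the distance to the nearest nonzero translate gives [|t| <= |y| / 2] for all nonzero
   translates [y] at once. *)
exists B, (d / 2); split; rewrite ?divr_gt0 // => t t0 td.
have tb (k : int) : x + k%:~R != 0 -> normc t <= normc (x + k%:~R) / 2.
  move=> /hd h; apply: le_trans (ltW td) _.
  by rewrite ler_pM2r // invr_gt0.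
have main : normc (phi J N (x + t) - (x == 0)%:R * t ^- N
   - \sum_(v < K.+1) neg_binom N v * t ^+ v * phi J (N + v) x) <= B * normc t ^+ K.+1.
  apply: (@normc_lim_le _ (fun M => phi_psum J N (x + t) M - (x == 0)%:R * t ^- N
   - \sum_(v < K.+1) neg_binom N v * t ^+ v * phi_psum J (N + v) x M)).
    apply: cvgB.
      by apply: cvgB; [exact: cvg_phi|exact: cvg_cst].
    apply: cvg_sumC => v _.
    by apply: cvgZC; apply: cvg_phi; rewrite addn_gt0 N0.
  move=> M; rewrite phi_psum_rem //.
  apply: le_trans (le_normcD _ _) _.
  rewrite /B mulrAC mulrDr; apply: lerD.
    have [->|x0] := eqVneq x 0.
      rewrite power_rem0 // normc0 mulr_ge0 ?normc_ge0 // mulr_ge0 //.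
      by rewrite exprn_ge0 // normc_ge0.
    by apply: hA => //; have := tb 0; rewrite addr0; apply.
  apply: le_trans (ler_normc_sum _ _ _) _.
  apply: le_trans (_ : \sum_(1 <= n < M)
    (A * normc t ^+ K.+1 * (2 * c ^+ (N + K.+1))) / n%:R ^+ 2 <= _).
    rewrite !big_nat; apply: ler_sum => n /andP[n0 _].
    rewrite normcM normc_sign mul1r; apply: le_trans (le_normcD _ _) _.
    have [x1 x2] := hx n n0.
    have [h1 h2] := hc n (N + K.+1)%N n0 (ltac:(by lia)).
    have t1 := tb n%:Z x1.
    have t2 := tb (- n%:Z); rewrite rmorphN /= in t2; have {}t2 := t2 x2.
    apply: le_trans (lerD (hA _ _ x1 t1) (hA _ _ x2 t2)) _.
    rewrite -mulrDr -!mulrA ler_wpM2l // ler_wpM2l ?exprn_ge0 ?normc_ge0 //.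
    rewrite -[X in _ <= X]/(2 * _) mulr_natl mulr2n; exact: lerD.
  rewrite -mulr_sumr
    (_ : _ * (4 * _) = A * normc t ^+ K.+1 * (2 * c ^+ (N + K.+1)) * 2); last by ring.
  rewrite ler_wpM2l ?sum_inv_sqr_le // !mulr_ge0 ?exprn_ge0 ?normc_ge0 //; exact: ltW.
rewrite exprD mulrCA hornerD hornerM hornerXn hornerC.
have -> : t ^+ N * phi J N (x + t) - ((x == 0)%:R
    + t ^+ N * (\poly_(v < K.+1) phi_coef J N x v).[t]) =
  t ^+ N * (phi J N (x + t) - (x == 0)%:R * t ^- N
   - \sum_(v < K.+1) neg_binom N v * t ^+ v * phi J (N + v) x).
  rewrite horner_poly !mulrBr mulrCA divff ?expf_neq0 // mulr1 opprD addrA.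
  congr (_ - _ * _); apply: eq_bigr => v _; rewrite phi_coef.unlock; ring.
by rewrite normcM normcX ler_wpM2l // exprn_ge0 // normc_ge0.
Qed.

End PhiExpansion.

Section Coefficients.
Variable R : realType.
Local Notation C := R[i].
Implicit Types (x y z t w : C) (J : label) (b : bool).
Local Notation int_sign := (@int_sign R).

Lemma poly_scale_eq K (E F : nat -> C) (c : C) :
  (forall v, E v = c * F v) -> \poly_(v < K) E v = c *: \poly_(v < K) F v.
Proof.
move=> EF; apply/polyP => i; rewrite coefZ !coef_poly; case: ifP => _.
  exact: EF.
by rewrite mulr0.
Qed.

(** The coefficient of [t ^- N] in [phi J N (x + t)], for [b = isII J]; it is the same for all
    [N]. *)
Definition polar_coef b x : C := if `[< Defs.integral x >] then signpow b x else 0.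

Lemma polar_coef_int b (k : int) : polar_coef b k%:~R = int_sign b k.
Proof.
rewrite /polar_coef; case: asboolP => [_|[]]; last by exists k.
exact: signpow_int.
Qed.

Lemma rising_ffact m nu : (0 < m)%N -> rising m nu = ((m + nu).-1 ^_ nu)%N.
Proof.
move=> m0; elim: nu => [|nu IH]; first by rewrite /rising big_geq.
rewrite /rising big_nat_recr //= -/(rising m nu) IH addnS /=.
have [n E] : exists n, (m + nu = n.+1)%N by exists (m + nu).-1; lia.
by rewrite E /= ffactSS mulnC.
Qed.

Lemma A_phi_coef J nu z (a m : nat) w : (0 < m)%N ->
  A J nu z a m w = phi_coef J m (a%:R * z - w) nu * a%:R ^+ (m + nu).
Proof.
move=> m0; rewrite /A phi_coef.unlock /neg_binom /sgn.
case: asboolP => [[k ->]|_]; congr (_ * _).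
  rewrite signpow_int -[k%:~R]add0r phi_shift ?addn_gt0 ?m0 // phi0 ?addn_gt0 ?m0 //.
  have -> : 'C((m + nu).-1, m.-1) = 'C((m + nu).-1, nu).
    by rewrite -bin_sub; [congr 'C(_, _)|]; lia.
  (* [A] carries [(-1) ^ m] at integers and [(-1) ^ nu] elsewhere. The two signs agree when [m + nu]
     is even, and [alpha] vanishes when it is odd. *)
  case: (boolP (odd (m + nu))) => oN; first by rewrite /alpha oN !mulr0.
  have -> : (-1) ^+ m = (-1) ^+ nu :> C.
    rewrite -signr_odd -[RHS]signr_odd; congr (_ ^+ _).
    by move: oN; rewrite oddD; do 2!case: odd.
  move: (alpha _ _ _) (int_sign _ _) => b1 b2; ring.
congr (_ * _); congr (_ * _); rewrite rising_ffact // -bin_ffact natrM mulfK //.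
Qed.

Lemma not_integral_shift x n : ~ Defs.integral x -> x + n%:R != 0 /\ x - n%:R != 0.
Proof.
move=> nx; split; apply/eqP => h; apply: nx.
  by exists (- n%:Z); rewrite rmorphN; apply/eqP; rewrite -addr_eq0; apply/eqP.
by exists n%:Z; apply/eqP; rewrite -subr_eq0; apply/eqP.
Qed.

(** [phi_jet_nonzero] leaves out the nonzero integers; they are moved to 0 by [phi_shift], which
    multiplies the polar and the regular part by the same sign. *)
Lemma phi_jet J N x K : (0 < N)%N ->
  jet (fun t => t ^+ N * phi J N (x + t))
    ((polar_coef (isII J) x)%:P + 'X^N * \poly_(v < K.+1) phi_coef J N x v) (N + K.+1).
Proof.
move=> N0; have [[k ->]|nx] := pselect (Defs.integral x); last first.
  have hx n : (0 < n)%N -> x + n%:R != 0 /\ x - n%:R != 0.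
    by move=> _; apply: not_integral_shift.
  rewrite /polar_coef asboolF //; have := phi_jet_nonzero J K N0 hx.
  suff -> : (x == 0) = false by [].
  by apply/negP => /eqP x0; apply: nx; exists 0.
have h0 n : (0 < n)%N -> (0 : C) + n%:R != 0 /\ (0 : C) - n%:R != 0.
  by move=> n0; rewrite add0r sub0r oppr_eq0 pnatr_eq0 -lt0n n0.
have := jetZ (int_sign (isII J) k) (phi_jet_nonzero J K N0 h0).
rewrite eqxx polar_coef_int => h.
suff <- : int_sign (isII J) k *: (1%:P + 'X^N * \poly_(v < K.+1) phi_coef J N 0 v)
   = (int_sign (isII J) k)%:P + 'X^N * \poly_(v < K.+1) phi_coef J N k%:~R v.
  apply: (jet_eq ltr01 _ h) => t _ _.
  by rewrite add0r [k%:~R + t]addrC phi_shift // mulrCA.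
have aux (P Q : {poly C}) c : P = c *: Q ->
    c *: (1%:P + 'X^N * Q) = c%:P + 'X^N * P.
  by move=> ->; rewrite scalerDr -scalerAr -(mul_polyC _ 1%:P) -polyCM mulr1.
refine (aux (\poly_(v < K.+1) phi_coef J N k%:~R v)
  (\poly_(v < K.+1) phi_coef J N 0 v) (int_sign (isII J) k) _).
apply: poly_scale_eq => v.
rewrite !phi_coef.unlock -[k%:~R]add0r phi_shift ?addn_gt0 ?N0 //.
by rewrite mulrCA.
Qed.

(** The Laurent expansion of one factor of [Phi], multiplied by [t ^ m] to become a polynomial; the
    constant term is the polar part. *)
Definition factor_poly J K z (a m : nat) w : {poly C} :=
  (polar_coef (isII J) (a%:R * z - w))%:P + 'X^m * \poly_(v < K.+1) A J v z a m w.

(** Substituting [a t] for [t] produces the polar term [(a t) ^- m], whose scaling is undone by the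
    factor [a ^ m] of [Phi]; the degree [v] part acquires the [a ^ (m + v)] built into [A]. *)
Lemma factor_jet J K z (a m : nat) w : (0 < a)%N -> (0 < m)%N ->
  jet (fun t => t ^+ m * (a%:R ^+ m * phi J m (a%:R * (z + t) - w)))
    (factor_poly J K z a m w) (m + K.+1).
Proof.
move=> a0 m0; have a0' : (a%:R : C) != 0 by rewrite pnatr_eq0 -lt0n.
have := jet_scale a0' (phi_jet J (a%:R * z - w) K m0).
have -> : ((polar_coef (isII J) (a%:R * z - w))%:P +
    'X^m * \poly_(v < K.+1) phi_coef J m (a%:R * z - w) v) \Po (a%:R *: 'X) =
    factor_poly J K z a m w.
  have aux (P Q : {poly C}) c : Q = a%:R ^+ m *: (P \Po (a%:R *: 'X)) ->
      (c%:P + 'X^m * P) \Po (a%:R *: 'X) = c%:P + 'X^m * Q.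
    move=> ->; rewrite comp_polyD comp_polyC comp_polyM comp_Xn_poly exprZn.
    by rewrite -scalerAl scalerAr.
  refine (aux (\poly_(v < K.+1) phi_coef J m (a%:R * z - w) v)
    (\poly_(v < K.+1) A J v z a m w) _ _).
  rewrite !poly_def linear_sum scaler_sumr /=.
  apply: eq_bigr => v _; rewrite A_phi_coef // comp_polyZ comp_Xn_poly exprZn.
  by rewrite !scalerA exprD; congr (_ *: _); ring.
apply: jet_eq ltr01 _ => t _ _.
rewrite exprMn (_ : a%:R * z - w + a%:R * t = a%:R * (z + t) - w); last by ring.
by rewrite [RHS]mulrCA [RHS]mulrA.
Qed.

Lemma polar_coef_shift b x (k : int) :
  polar_coef b (x + k%:~R) = int_sign b k * polar_coef b x.
Proof.
have [[j ->]|nx] := pselect (Defs.integral x).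
  by rewrite -rmorphD !polar_coef_int int_signD mulrC.
rewrite /polar_coef !asboolF ?mulr0 // => -[j xj].
by apply: nx; exists (j - k); rewrite rmorphB /= -xj addrK.
Qed.

Lemma phi_coef_shift J N x (k : int) v : (0 < N)%N ->
  phi_coef J N (x + k%:~R) v = int_sign (isII J) k * phi_coef J N x v.
Proof.
by move=> N0; rewrite !phi_coef.unlock phi_shift ?addn_gt0 ?N0 // mulrCA.
Qed.

Lemma A_shift J nu z (a m : nat) w (k : int) : (0 < m)%N ->
  A J nu (z + k%:~R) a m w = int_sign (isII J) (a%:Z * k) * A J nu z a m w.
Proof.
move=> m0; rewrite !A_phi_coef // mulrA; congr (_ * _).
rewrite -phi_coef_shift //; congr phi_coef.
by rewrite mulrDr rmorphM /= addrAC.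
Qed.

Lemma factor_poly_shift J K z (a m : nat) w (k : int) : (0 < m)%N ->
  factor_poly J K (z + k%:~R) a m w = int_sign (isII J) (a%:Z * k) *: factor_poly J K z a m w.
Proof.
move=> m0; have aux (P Q : {poly C}) c c' s : c' = s * c -> P = s *: Q ->
    c'%:P + 'X^m * P = s *: (c%:P + 'X^m * Q).
  by move=> -> ->; rewrite scalerDr -scalerAr polyCM mul_polyC.
refine (aux (\poly_(v < K.+1) A J v (z + k%:~R) a m w)
  (\poly_(v < K.+1) A J v z a m w) _ _ (int_sign (isII J) (a%:Z * k)) _ _).
  by rewrite -polar_coef_shift; congr polar_coef; rewrite mulrDr rmorphM /= addrAC.
apply: poly_scale_eq => v; exact: A_shift.
Qed.

End Coefficients.

(** * Coefficients of products *)

Section ProductCoefficients.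
Variable R : realType.
Local Notation C := R[i].

(** Entries of a tuple with sum [d] are at most [d], so the sum over an infinite type of tuples is
    one over functions into ['I_K]. *)
Lemma fsbig_ffun_sum (V : nmodType) (U : finType) (K d : nat) (G : {ffun U -> nat} -> V) :
  (d < K)%N ->
  \sum_(nu \in [set nu : {ffun U -> nat} | (\sum_u nu u)%N = d]) G nu =
  \sum_(f : {ffun U -> 'I_K} | (\sum_u f u == d)%N) G [ffun u => nat_of_ord (f u)].
Proof.
move=> dK.
pose h (f : {ffun U -> 'I_K}) : {ffun U -> nat} := [ffun u => nat_of_ord (f u)].
have hinj : injective h.
  move=> f g /ffunP fg; apply/ffunP => u; apply: val_inj.
  by have := fg u; rewrite !ffunE.
have hsum f : (\sum_u h f u = \sum_u f u)%N.
  by apply: eq_bigr => u _; rewrite ffunE.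
pose r := map h (seq.filter (fun f : {ffun U -> 'I_K} => \sum_u f u == d)%N (enum predT)).
rewrite (fsbig_fwiden r).
- by rewrite big_map big_filter big_enum_cond.
- move=> nu /= nud; apply/mapP.
  have nuK u : (nu u < K)%N.
    by apply: leq_ltn_trans dK; rewrite -nud (bigD1 u) //= leq_addr.
  exists [ffun u => Ordinal (nuK u)].
    rewrite mem_filter mem_enum andbT -nud; apply/eqP/eq_bigr => u _.
    by rewrite ffunE.
  by apply/ffunP => u; rewrite !ffunE.
- by rewrite map_inj_uniq // filter_uniq // enum_uniq.
- move=> nu [/mapP[f]]; rewrite mem_filter => /andP[/eqP fd _] -> [].
  by rewrite /= hsum.
Qed.

Lemma coef_prod_poly (S : comNzRingType) (U : finType) (E : U -> nat -> S) (K d : nat) :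
  (\prod_u \poly_(v < K) E u v)`_d =
  \sum_(f : {ffun U -> 'I_K} | (\sum_u f u == d)%N) \prod_u E u (f u).
Proof.
under eq_bigr do rewrite poly_def.
rewrite bigA_distr_bigA coef_sum [RHS]big_mkcond /=; apply: eq_bigr => f _.
have -> : \prod_u (E u (f u) *: 'X^(f u)) =
    (\prod_u E u (f u)) *: 'X^(\sum_u f u) :> {poly S}.
  elim/big_rec3: _ => [|u p c n _ ->]; first by rewrite scale1r expr0.
  by rewrite -scalerAl -scalerAr scalerA exprD.
by rewrite coefZ coefXn eq_sym; case: eqP; rewrite ?mulr1 ?mulr0.
Qed.

Section Family.
Variables (r jI : nat) (a m : 'I_r -> nat) (w : 'I_r -> C).

Definition local_poly K z : {poly C} :=
  \prod_(l < r) factor_poly (lab jI l) K z (a l) (m l) (w l).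

(** The tuples that produce total degree [d] when the constant polar term is chosen at the indices
    in [L] and degree [m u + nu u] at each other index [u]. *)
Definition level_set (d : nat) (L : {set 'I_r}) : set (ctuple L) :=
  [set nu | (\sum_k nu k + \sum_(u in ~: L) m u)%N = d].

Lemma isII_lab (l : 'I_r) : isII (lab jI l) = deltaII jI l.
Proof. by rewrite /lab; case: ifP. Qed.

(** Expanding the product of binomials yields one term for each subset [L] of polar choices. Outside
    [Rset] some polar coefficient is 0; if the degrees [m u] outside [L] already exceed [d], the
    level set is empty. *)
Lemma coef_local_poly K z d : (d < K.+1)%N ->
  (local_poly K z)`_d = \sum_(L in Rset a w z)
    \sum_(nu \in @level_set d L) summand jI a m w z nu.
Proof.
move=> dK; rewrite /local_poly bigA_distr coef_sum [RHS]big_mkcond /=.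
apply: eq_bigr => L _.
rewrite (bigID (mem L)) /=.
rewrite (eq_bigr (fun l => (polar_coef (isII (lab jI l)) ((a l)%:R * z - w l))%:P)); last first.
  by move=> l lL; rewrite lL.
rewrite -rmorph_prod /=.
rewrite (eq_bigr (fun l => 'X^(m l) *
  \poly_(v < K.+1) A (lab jI l) v z (a l) (m l) (w l))); last first.
  by move=> l /negPf ->.
rewrite big_split /= coefCM.
have -> : \prod_(l < r | l \notin L) 'X^(m l) = 'X^(\sum_(u in ~: L) m u) :> {poly C}.
  rewrite -prodrXr; apply: eq_bigl => l; by rewrite inE.
have -> : \prod_(l < r | l \notin L) \poly_(v < K.+1) A (lab jI l) v z (a l) (m l) (w l) =
  \prod_(u : {k : 'I_r | k \in ~: L})
    \poly_(v < K.+1) A (lab jI (val u)) v z (a (val u)) (m (val u)) (w (val u)) :> {poly C}.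
  pose F l := \poly_(v < K.+1) A (lab jI l) v z (a l) (m l) (w l).
  rewrite -[RHS](@big_sub _ _ _ 'I_r (mem (~: L)) F).
  by apply: eq_bigl => l; rewrite inE.
rewrite coefXnM coef_prod_poly.
have sL : \prod_(l in L) polar_coef (isII (lab jI l)) ((a l)%:R * z - w l) =
   if L \in Rset a w z then \prod_(l in L) signpow (deltaII jI l) ((a l)%:R * z - w l) else 0.
  rewrite inE; case: asboolP => hL.
    by apply: eq_bigr => l lL; rewrite /polar_coef isII_lab asboolT //; exact: hL.
  have /existsNP[l /not_implyP[lL nl]] := hL.
  by apply/eqP/prodf_eq0; exists l => //; rewrite /polar_coef asboolF.
rewrite sL; case: ifP => LR; last by rewrite mul0r.
case: ltnP => hd.
  rewrite mulr0 fsbig1 // => nu; rewrite /level_set /= => E.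
  by move: hd; rewrite -E ltnNge leq_addl.
have -> : @level_set d L = [set nu : {ffun {k : 'I_r | k \in ~: L} -> nat} |
   (\sum_u nu u)%N = (d - \sum_(u in ~: L) m u)%N].
  by apply/seteqP; split=> nu /= E; [rewrite -E addnK|rewrite /level_set /= E subnK].
have dK' : (d - \sum_(u in ~: L) m u < K.+1)%N by apply: leq_ltn_trans dK; exact: leq_subr.
rewrite (@fsbig_ffun_sum C _ _ _ _ dK') mulr_sumr; apply: eq_bigr => f _.
by rewrite /summand; congr (_ * _); apply: eq_bigr => u _; rewrite ffunE.
Qed.

End Family.
End ProductCoefficients.

(** * A maximum principle for periodic functions *)

Section Harmonic.
Variable R : realType.
Local Notation C := R[i].
Implicit Types (z t : C).

(** The five-point discrete Laplacian, not divided by [s ^ 2]. *)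
Definition laplace_diff (u : C -> R) z (s : R) : R :=
  u (z + s%:C) + u (z - s%:C) + u (z + (0 +i* s)) + u (z - (0 +i* s)) - 4 * u z.

Lemma periodic_reduce (u : C -> R) : (forall z, u (z + 2) = u z) ->
  forall z, exists x, 0 <= x <= 2 /\ u z = u (x +i* Im z).
Proof.
move=> per z.
pose F (k : int) : C := (2 * k%:~R)%:C.
have FS k y : u (y + F (k + 1)) = u (y + F k).
  rewrite -[RHS]per; congr u; rewrite -addrA; congr (_ + _).
  by rewrite /F intrD mulrDr mulr1 rmorphD /= (natC R 2).
have perk (k : int) y : u (y + F k) = u y.
  elim/int_rect: k => [|n IH|n IH].
  - by rewrite /F mulr0 addr0.
  - by rewrite (_ : n.+1%:Z = n%:Z + 1) ?FS //; lia.
  - by rewrite -[LHS]FS (_ : - n.+1%:Z + 1 = - n%:Z) //; lia.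
exists (Re z - 2 * (Num.floor (Re z / 2))%:~R); split; last first.
  rewrite -(perk (- Num.floor (Re z / 2)) z); congr (u _).
  by case: z => x y; rewrite /F rmorphN mulrN; simpc.
have h1 := floor_le (Re z / 2); have h2 := floorD1_gt (Re z / 2).
rewrite intrD in h2.
by apply/andP; split; lra.
Qed.

Lemma rectangle_max (v : C -> R) (Y : R) : 0 <= Y ->
  (forall z (e : R), 0 < e -> exists d : R, 0 < d /\
    forall t, normc t < d -> `|v (z + t) - v z| <= e) ->
  exists z0, [/\ 0 <= Re z0 <= 2, - Y <= Im z0 <= Y &
    forall x y, 0 <= x <= 2 -> - Y <= y <= Y -> v (x +i* y) <= v z0].
Proof.
move=> Y0 vc.
pose f (p : R * R) : R := v (p.1 +i* p.2).
have fc : continuous f.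
  move=> p; apply/cvgrPdistC_le => e e0.
  have [d [d0 hd]] := vc (p.1 +i* p.2) e e0.
  have d2 : 0 < d / 2 by rewrite divr_gt0.
  apply: filterS (nbhsx_ballx (p : (R * R)%type) _ d2) => q [q1 q2].
  rewrite /f.
  have -> : q.1 +i* q.2 = p.1 +i* p.2 + ((q.1 - p.1) +i* (q.2 - p.2)).
    by simpc; rewrite !addrA; congr (_ +i* _); ring.
  apply: hd; apply: le_lt_trans (normc_le_ReIm _) _ => /=.
  move: q1 q2; rewrite /ball /= /ball_ => q1 q2.
  rewrite (splitr d) ltrD // distrC; [exact: q1|exact: q2].
have cA : compact (`[0, 2]%classic `*` `[- Y, Y]%classic : set (R * R)).
  by apply: compact_setX; apply: segment_compact.
have A0 : (`[0, 2]%classic `*` `[- Y, Y]%classic : set (R * R)) !=set0.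
  by exists (0, 0); split; rewrite /= in_itv /=; apply/andP; split; rewrite ?oppr_le0 ?lexx ?ler0n.
have [[x y] /=] := compact_EVT_max A0 cA (continuous_subspaceT fc).
rewrite inE => -[/=]; rewrite !in_itv /= => hx hy hm.
exists (x +i* y); split=> // x' y' hx' hy'.
by apply: (hm (x', y')); rewrite inE; split; rewrite /= in_itv /=.
Qed.

(* [u - D y / Y + eps y ^ 2] cannot be maximal inside the rectangle of height
   [2 Y], as its second difference is positive for small steps, and on the two
   horizontal sides it is almost at most 0; then [eps] tends to 0 and [Y] to
   infinity. *)
Lemma periodic_subharmonic_le0 (u : C -> R) (D : R) :
  (forall z, u (z + 2) = u z) ->
  (forall z, exists B d : R, [/\ 0 <= B, 0 < d &
    forall s, 0 < s -> s < d -> - (B * s ^+ 3) <= laplace_diff u z s]) ->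
  (forall z (e : R), 0 < e -> exists d : R, 0 < d /\
    forall t, normc t < d -> `|u (z + t) - u z| <= e) ->
  (forall e : R, 0 < e -> exists Y, forall z, Y <= Im z -> u z <= D + e) ->
  (forall e : R, 0 < e -> exists Y, forall z, Im z <= - Y -> u z <= - D + e) ->
  forall z, u z <= 0.
Proof.
move=> per loc cont limp limm z; apply/ler_addgt0Pr => e e0; rewrite add0r.
have e3 : 0 < e / 3 by rewrite divr_gt0.
have [Y1 hY1] := limp _ e3; have [Y2 hY2] := limm _ e3.
(* The budget [e] is spent in thirds: the excess of [u] over its limits on the horizontal sides, the
   term [eps Y ^ 2], and [D / Y] times [Im z] at the given [z], which the last entry of the maximum
   controls. *)
pose Y := Num.max 1 (Num.max (Num.max Y1 Y2) (Num.max `|Im z| (`|D * Im z| / (e / 3)))).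
have Yge1 : 1 <= Y by rewrite le_max lexx.
have YgeY1 : Y1 <= Y by rewrite !le_max lexx !orbT.
have YgeY2 : Y2 <= Y by rewrite !le_max lexx !orbT.
have Ygez : `|Im z| <= Y by rewrite !le_max lexx !orbT.
have YgeD : `|D * Im z| / (e / 3) <= Y by rewrite !le_max lexx !orbT.
have Ygt0 : 0 < Y by apply: lt_le_trans Yge1.
pose eps := e / (3 * Y ^+ 2).
have eps0 : 0 < eps by rewrite divr_gt0 // mulr_gt0 // exprn_gt0.
have epsY : eps * Y ^+ 2 = e / 3.
  have Ysq : Y ^+ 2 != 0 by rewrite expf_neq0 // gt_eqF.
  by rewrite /eps; move: (Y ^+ 2) Ysq => y y0; field.
clearbody eps; clearbody Y.
pose v z := u z - D / Y * Im z + eps * Im z ^+ 2.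
have vcont : forall z (e : R), 0 < e -> exists d : R, 0 < d /\
    forall t, normc t < d -> `|v (z + t) - v z| <= e.
  move=> z1 e' e'0.
  have e'3 : 0 < e' / 3 by rewrite divr_gt0.
  have [d [d0 hd]] := cont z1 _ e'3.
  pose k1 := `|D / Y| + 1; pose k2 := eps * (2 * `|Im z1| + 1) + 1.
  have k10 : 0 < k1 by rewrite ltr_wpDl.
  have k20 : 0 < k2.
    by rewrite ltr_wpDl // mulr_ge0 ?(ltW eps0) // addr_ge0 // mulr_ge0.
  exists (Num.min (Num.min d 1) (Num.min (e' / 3 / k1) (e' / 3 / k2))); split.
    by rewrite !lt_min d0 ltr01 !divr_gt0.
  move=> t; rewrite !lt_min => /andP[/andP[td t1] /andP[tk1 tk2]].
  have it := Im_le_normc t.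
  have -> : v (z1 + t) - v z1 = (u (z1 + t) - u z1) - D / Y * Im t
     + eps * (2 * Im z1 + Im t) * Im t by rewrite /v ImD; ring.
  have h1 : `|D / Y * Im t| <= e' / 3.
    rewrite normrM; apply: le_trans (_ : k1 * normc t <= _).
      by apply: ler_pM => //; rewrite lerDl.
    by rewrite mulrC -ler_pdivlMr // ltW.
  have h2 : `|eps * (2 * Im z1 + Im t) * Im t| <= e' / 3.
    rewrite normrM; apply: le_trans (_ : k2 * normc t <= _).
      apply: ler_pM => //.
      rewrite normrM gtr0_norm // /k2.
      apply: le_trans (_ : eps * (2 * `|Im z1| + 1) <= _); last by rewrite lerDl.
      rewrite ler_wpM2l ?(ltW eps0) //; apply: le_trans (ler_normD _ _) _.
      rewrite normrM ger0_norm // lerD2l; apply: le_trans it _; exact: ltW.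
    by rewrite mulrC -ler_pdivlMr // ltW.
  have h0 := hd t td.
  apply: le_trans (ler_normD _ _) _; apply: le_trans (lerD (ler_normB _ _) (lexx _)) _.
  lra.
have [z0 [_ hi hmax]] := rectangle_max (ltW Ygt0) vcont.
(* The correction terms depend on the imaginary part alone, so periodicity spreads the maximum over
   the whole horizontal band and the vertical sides are no boundary. *)
have vmax z' : - Y <= Im z' <= Y -> v z' <= v z0.
  move=> hz'; have [x [hx ux]] := periodic_reduce per z'.
  have := hmax x (Im z') hx hz'; rewrite /v /= -ux; exact.
have vz0 : v z0 <= e / 3 + e / 3.
  have DY : D / Y * Y = D by rewrite divfK // gt_eqF.
  have [y1|] := leP Y (Im z0).
    have yY : Im z0 = Y by apply/le_anti; rewrite y1 andbT; case/andP: hi.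
    have := hY1 z0; rewrite yY => /(_ YgeY1); rewrite /v yY epsY DY; lra.
  have [y1 _|y1 y2] := leP (Im z0) (- Y).
    have yY : Im z0 = - Y by apply/le_anti; rewrite y1 /=; case/andP: hi.
    have := hY2 z0; rewrite yY lerN2 => /(_ YgeY2).
    rewrite /v yY sqrrN epsY mulrN DY; lra.
  exfalso.
  have [B [d [B0 d0 hd]]] := loc z0.
  have B1 : 0 < B + 1 by rewrite ltr_wpDl.
  (* A step that stays in the band. The term [eps y ^ 2] adds [2 eps s ^ 2] to the second difference
     and the linear term adds nothing, so a maximum would force [2 eps <= B s], against
     [s (B + 1) <= eps]. *)
  pose s := Num.min (Num.min (d / 2) (eps / (B + 1))) (Num.min (Y - Im z0) (Y + Im z0)).
  have s0 : 0 < s.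
    by rewrite !lt_min !divr_gt0 //= subr_gt0 y2 /= -ltrBlDl sub0r.
  have sd : s < d.
    apply: le_lt_trans (_ : d / 2 < d); first by rewrite !ge_min lexx.
    by rewrite ltr_pdivrMr // mulr_natr mulr2n ltrDl.
  have sB : s * (B + 1) <= eps by rewrite -ler_pdivlMr // !ge_min lexx ?orbT.
  have sy1 : s <= Y - Im z0 by rewrite !ge_min lexx ?orbT.
  have sy2 : s <= Y + Im z0 by rewrite !ge_min lexx ?orbT.
  have := hd s s0 sd; rewrite /laplace_diff.
  have v1 := vmax (z0 + s%:C); have v2 := vmax (z0 - s%:C).
  have v3 := vmax (z0 + (0 +i* s)); have v4 := vmax (z0 - (0 +i* s)).
  rewrite /v !ImD !ImN /= in v1 v2 v3 v4.
  have {}v1 := v1 (ltac:(by apply/andP; split; lra)).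
  have {}v2 := v2 (ltac:(by apply/andP; split; lra)).
  have {}v3 := v3 (ltac:(by apply/andP; split; lra)).
  have {}v4 := v4 (ltac:(by apply/andP; split; lra)).
  move=> hL.
  have s2 : 0 < s ^+ 2 by rewrite exprn_gt0.
  have : 2 * eps * s ^+ 2 <= B * s ^+ 3.
    move: v1 v2 v3 v4 hL; set q := D / Y; set y := Im z0; nra.
  rewrite (_ : B * s ^+ 3 = (B * s) * s ^+ 2); last by ring.
  rewrite ler_pM2r // => h.
  nra.
have vz : v z <= v z0 by apply: vmax; rewrite -ler_norml.
have DYz : D / Y * Im z <= e / 3.
  rewrite mulrAC ler_pdivrMr //; apply: le_trans (ler_norm _) _.
  by rewrite [leRHS]mulrC -ler_pdivrMr.
have ez : 0 <= eps * Im z ^+ 2 by rewrite mulr_ge0 ?sqr_ge0 // ltW.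
by move: vz vz0 DYz ez; rewrite {1}/v; lra.
Qed.

End Harmonic.

Section PeriodicConst.
Variable R : realType.
Local Notation C := R[i].
Implicit Types (z t : C).

Lemma jet_at0 g (p : {poly C}) : jet g p 1 -> p`_0 = g 0 ->
  exists A d : R, [/\ 0 <= A, 0 < d &
    forall t, normc t < d -> normc (g t - g 0) <= A * normc t].
Proof.
move=> gp p0; have : jet g (p`_0)%:P 1.
  by apply: jet_trunc gp => -[|//] _; rewrite coefC.
move=> [B [d [B0 d0 h]]]; exists B, d; split=> // t td.
have [->|t0] := eqVneq t 0; first by rewrite subrr normc0 mulr0.
by have := h t t0 td; rewrite hornerC p0 expr1.
Qed.

(** The numbers 1, -1, i, -i have sum 0, and so have their squares. *)
Lemma quad_laplace (q0 q1 q2 : C) (s : R) :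
  let q t := q0 + q1 * t + q2 * t ^+ 2 in
  q s%:C + q (- s%:C) + q (0 +i* s) + q (- (0 +i* s)) = 4 * q0.
Proof.
move=> q; have E : (0 +i* s) ^+ 2 = - (s%:C ^+ 2).
  by rewrite !expr2; simpc.
rewrite /q !sqrrN E; move: (0 +i* s) (s%:C) => x y; ring.
Qed.

(** With [c] the mean of the limits, [h - c] tends to [D] and [- D], the opposite limits that
    [periodic_subharmonic_le0] asks for. Applied to the real part of [k (h - c)] for [k] among 1,
    -1, i, -i, it bounds real and imaginary part from both sides by 0. *)
Lemma periodic_const (h : C -> C) (Lp Lm : C) :
  (forall z, h (z + 2) = h z) ->
  (forall z, exists p : {poly C}, p`_0 = h z /\ jet (fun t => h (z + t)) p 3) ->
  (forall e : R, 0 < e -> exists Y, forall z, Y <= Im z -> normc (h z - Lp) <= e) ->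
  (forall e : R, 0 < e -> exists Y, forall z, Im z <= - Y -> normc (h z - Lm) <= e) ->
  forall z, h z = (Lp + Lm) / 2.
Proof.
move=> per jets limp limm.
pose c := (Lp + Lm) / 2; pose D := (Lp - Lm) / 2.
have cD : c + D = Lp by rewrite /c /D; field.
have cmD : c - D = Lm by rewrite /c /D; field.
change (forall z, h z = c); clearbody c D.
have main k : normc k = 1 -> forall z, Re (k * (h z - c)) <= 0.
  move=> k1; have Rek x : Re (k * x) <= normc x.
    apply: le_trans (ler_norm _) (le_trans (Re_le_normc _) _).
    by rewrite normcM k1 mul1r.
  have Rek' x : `|Re (k * x)| <= normc x.
    by apply: le_trans (Re_le_normc _) _; rewrite normcM k1 mul1r.
  have ReB x y : Re (k * x) - Re (k * y) = Re (k * (x - y)).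
    by rewrite mulrBr ReD ReN.
  apply: (@periodic_subharmonic_le0 _ (fun z => Re (k * (h z - c))) (Re (k * D))).
  - by move=> z; rewrite per.
  - move=> z; have [p [p0 hp]] := jets z.
    pose q := (p`_0)%:P + p`_1 *: 'X + p`_2 *: 'X^2.
    have {hp}[B [d [B0 d0 hp]]] : jet (fun t => h (z + t)) q 3.
      apply: jet_trunc hp => i i3; rewrite !coefD !coefZ coefC coefX coefXn.
      by case: i i3 => [|[|[|//]]] _; rewrite /= ?mulr0 ?mulr1 ?addr0 ?add0r.
    exists (4 * B), d; split=> // [|s s0 sd]; first by rewrite mulr_ge0.
    have ns : normc s%:C = s by rewrite normc_real gtr0_norm.
    have nis : normc (0 +i* s) = s.
      by rewrite /normc expr0n /= add0r sqrtr_sqr gtr0_norm.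
    have sC0 : s%:C != 0 by rewrite -normc_gt0 ns.
    have siC0 : (0 +i* s) != 0 by rewrite -normc_gt0 nis.
    have h1 := hp s%:C sC0; have h3 := hp (0 +i* s) siC0.
    have h2 := hp (- s%:C); have h4 := hp (- (0 +i* s)).
    rewrite oppr_eq0 normcN in h2; rewrite oppr_eq0 normcN in h4.
    have {}h2 := h2 sC0; have {}h4 := h4 siC0.
    rewrite ns in h1; rewrite ns in h2; rewrite nis in h3; rewrite nis in h4.
    have {}h1 := h1 sd; have {}h2 := h2 sd; have {}h3 := h3 sd; have {}h4 := h4 sd.
    have qE t : q.[t] = p`_0 + p`_1 * t + p`_2 * t ^+ 2.
      by rewrite /q !hornerD !hornerZ hornerC hornerX hornerXn.
    have := quad_laplace p`_0 p`_1 p`_2 s; rewrite /= -!qE p0 => Q.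
    have E : laplace_diff (fun z => Re (k * (h z - c))) z s =
       Re (k * (h (z + s%:C) - q.[s%:C])) + Re (k * (h (z - s%:C) - q.[- s%:C]))
     + Re (k * (h (z + (0 +i* s)) - q.[0 +i* s]))
     + Re (k * (h (z - (0 +i* s)) - q.[- (0 +i* s)])).
      rewrite -!ReD -!mulrDr.
      have -> : h (z + s%:C) - q.[s%:C] + (h (z - s%:C) - q.[- s%:C])
        + (h (z + (0 +i* s)) - q.[0 +i* s])
        + (h (z - (0 +i* s)) - q.[- (0 +i* s)]) =
        (h (z + s%:C) - c) + (h (z - s%:C) - c) + (h (z + (0 +i* s)) - c)
        + (h (z - (0 +i* s)) - c) - 4 * (h z - c).
        rewrite mulrBr -Q.
        by ring.
      rewrite /laplace_diff.
      move: (h (z + s%:C) - c) (h (z - s%:C) - c) (h (z + (0 +i* s)) - c)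
        (h (z - (0 +i* s)) - c) (h z - c) => x1 x2 x3 x4 x0.
      have -> : k * (x1 + x2 + x3 + x4 - 4 * x0) =
          k * x1 + k * x2 + k * x3 + k * x4 - (4 : R)%:C * (k * x0).
        by rewrite -[(4 : R)%:C](natC R 4); ring.
      by rewrite ReD ReN ReMr !ReD.
    rewrite E.
    have l x : - normc x <= Re (k * x) by have := Rek' x; rewrite ler_norml => /andP[].
    have := l (h (z + s%:C) - q.[s%:C]); have := l (h (z - s%:C) - q.[- s%:C]).
    have := l (h (z + (0 +i* s)) - q.[0 +i* s]).
    have := l (h (z - (0 +i* s)) - q.[- (0 +i* s)]).
    move: h1 h2 h3 h4 => /=; lra.
  - move=> z e e0; have [p [p0 hp]] := jets z.
    have [||A [d [A0 d0 hA]]] := @jet_at0 (fun t => h (z + t)) p.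
    + exact: jet_weaken hp.
    + by rewrite p0 addr0.
    exists (Num.min d (e / (A + 1))); split.
      by rewrite lt_min d0 divr_gt0 // ltr_wpDl.
    move=> t; rewrite lt_min => /andP[td te].
    rewrite ReB; apply: le_trans (Rek' _) _.
    rewrite opprB addrA subrK; have := hA t td; rewrite addr0 => /le_trans; apply.
    have : normc t * (A + 1) <= e by rewrite -ler_pdivlMr ?ltr_wpDl // ltW.
    have := normc_ge0 t; nra.
  - move=> e e0; have [Y hY] := limp e e0; exists Y => z zY.
    rewrite -lerBlDl ReB; apply: le_trans (Rek _) _.
    by rewrite -addrA -opprD cD hY.
  - move=> e e0; have [Y hY] := limm e e0; exists Y => z zY.
    rewrite -lerBlDl -ReN -mulrN ReB; apply: le_trans (Rek _) _.
    by rewrite -addrA -opprD cmD hY.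
move=> z; apply/eqP; rewrite -subr_eq0; apply/eqP.
have n1 : normc (-1 : C) = 1 by rewrite normcN normc1.
have ni : normc (0 +i* 1 : C) = 1.
  by rewrite /normc expr0n /= add0r expr1n sqrtr1.
have a1 := main 1 (normc1 R) z; have a2 := main (-1) n1 z.
have a3 := main (0 +i* 1) ni z.
have a4 := main (- (0 +i* 1)); rewrite normcN in a4; have {}a4 := a4 ni z.
rewrite mul1r in a1; rewrite mulN1r ReN in a2; rewrite mulNr ReN in a4.
case: (h z - c) a1 a2 a3 a4 => x y /=; rewrite mul0r mul1r => a1 a2 a3 a4.
by apply/eqP; rewrite eq_complex /=; apply/andP; split; apply/eqP; lra.
Qed.

End PeriodicConst.

(** * Behaviour of phi at the two ends of the strip *)

Section AtanSums.
Variable R : realType.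
Implicit Types (x y : R).

Lemma atan_increment x y : x < y -> exists c, x < c < y /\
  atan y - atan x = (1 + c ^+ 2)^-1 * (y - x).
Proof.
move=> xy; have [c] := @MVT R atan (fun c => (1 + c ^+ 2)^-1) x y xy
  (fun c _ => is_derive1_atan c)
  (continuous_subspaceT (fun c => @continuous_atan R c)).
by rewrite in_itv /= => cxy ->; exists c.
Qed.

Lemma atan_le_id x : 0 <= x -> atan x <= x.
Proof.
rewrite le_eqVlt => /predU1P[<-|x0]; first by rewrite atan0.
have [c [_]] := atan_increment x0; rewrite atan0 !subr0 => ->.
rewrite ler_piMl ?(ltW x0) // invf_le1 ?lerDl ?sqr_ge0 //.
by rewrite ltr_pwDl // sqr_ge0.
Qed.

Lemma atan_step y (n : nat) : 0 < y ->
  y / (y ^+ 2 + n.+1%:R ^+ 2) <= atan (n.+1%:R / y) - atan (n%:R / y)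
  <= y / (y ^+ 2 + n%:R ^+ 2).
Proof.
move=> y0; have lt : n%:R / y < n.+1%:R / y by rewrite ltr_pM2r ?invr_gt0 // ltr_nat.
have [c [/andP[c1 c2] ->]] := atan_increment lt.
have n0 : 0 <= n%:R :> R by [].
have c0 : 0 < c by apply: le_lt_trans c1; rewrite divr_ge0 // ltW.
have yc1 : n%:R < c * y by rewrite -ltr_pdivrMr.
have yc2 : c * y < n.+1%:R by rewrite -ltr_pdivlMr.
have -> : n.+1%:R / y - n%:R / y = y^-1 by rewrite -mulrBl -natr1 addrAC subrr add0r mul1r.
have -> : (1 + c ^+ 2)^-1 * y^-1 = y / (y ^+ 2 + (c * y) ^+ 2).
  field; rewrite (gt_eqF y0) /=; apply/andP; split; apply/eqP; nra.
have yy : 0 < y ^+ 2 by rewrite exprn_gt0.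
have pos u : 0 < y ^+ 2 + u ^+ 2 by rewrite ltr_pwDl // sqr_ge0.
by apply/andP; split; rewrite ler_pM2l // lef_pV2 ?posrE //; rewrite lerD2l;
  apply: lerXn2r; rewrite ?nnegrE ?ler0n // ltW // mulr_gt0.
Qed.

Lemma lorentz_sum_le y M : 0 < y ->
  \sum_(1 <= n < M) y / (y ^+ 2 + n%:R ^+ 2) <= pi / 2.
Proof.
move=> y0; apply: ltW; case: M => [|M]; first by rewrite big_geq // divr_gt0 // pi_gt0.
apply: le_lt_trans (atan_ltpi2 (M%:R / y)).
elim: M => [|M IH]; first by rewrite big_geq // mul0r atan0.
rewrite big_nat_recr //=; have /andP[h _] := atan_step M y0.
lra.
Qed.

(** Summing from 1 loses the integral over the first unit interval, [atan (1 / y)], which is at most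
    [1 / y]. *)
Lemma lorentz_sum_ge y M : 0 < y ->
  atan (M.+1%:R / y) - y^-1 <= \sum_(1 <= n < M.+1) y / (y ^+ 2 + n%:R ^+ 2).
Proof.
move=> y0; have y1 : atan y^-1 <= y^-1 by rewrite atan_le_id // invr_ge0 ltW.
apply: le_trans (_ : atan (M.+1%:R / y) - atan (1 / y) <= _).
  by rewrite lerD2l lerN2 div1r.
elim: M => [|M IH]; first by rewrite big_geq // subrr.
rewrite big_nat_recr //=; have /andP[_ h] := atan_step M.+1 y0.
lra.
Qed.

End AtanSums.

Section Decay.
Variable R : realType.
Local Notation C := R[i].
Implicit Types (x y : R) (z : C).

Definition lorentz y (n : nat) : R := (y ^+ 2 + n%:R ^+ 2)^-1.

Lemma normc_inv_sqr_le y n z : 0 < y -> Im z = y -> n%:R <= `|Re z| ->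
  normc z^-1 ^+ 2 <= lorentz y n.
Proof.
move=> y0 zy nz; rewrite normcV exprVn normc_sq zy.
have y2 : 0 < y ^+ 2 by rewrite exprn_gt0.
have p1 : 0 < y ^+ 2 + n%:R ^+ 2 by rewrite ltr_pwDl ?sqr_ge0.
have p2 : 0 < Re z ^+ 2 + y ^+ 2 by rewrite ltr_wpDl ?sqr_ge0.
rewrite lef_pV2 ?posrE // addrC lerD2r -(real_normK (num_real (Re z))).
by rewrite lerXn2r ?nnegrE.
Qed.

(** The index [n.-1] is there because for [0 <= Re z <= 1] the real part of [z - n] is only known to
    have modulus at least [n - 1]. Each of the two sums contributes [pi / 2 / y], and the central
    term and the term [n = 1] of the second sum contribute [1 / y] each. *)
Lemma lorentz_series_le y (f0 : C) (f : nat -> C) M : 1 <= y ->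
  normc f0 <= lorentz y 0 ->
  (forall n, (0 < n)%N -> normc (f n) <= lorentz y n + lorentz y n.-1) ->
  normc (f0 + \sum_(1 <= n < M) f n) <= (pi + 2) / y.
Proof.
move=> y1 hf0 hf; have y0 : 0 < y by apply: lt_le_trans y1.
have g0 : lorentz y 0 <= y^-1.
  by rewrite /lorentz expr0n addr0 lef_pV2 ?posrE ?exprn_gt0 // expr2 ler_peMr // ltW.
have S p : \sum_(1 <= n < p) lorentz y n <= pi / 2 / y.
  rewrite ler_pdivlMr // mulr_suml; apply: le_trans (lorentz_sum_le p y0).
  by apply: ler_sum => n _; rewrite mulrC.
have S' : \sum_(1 <= n < M) lorentz y n.-1 <= y^-1 + pi / 2 / y.
  case: M => [|[|M]].
  - by rewrite big_geq // addr_ge0 ?invr_ge0 ?divr_ge0 ?pi_ge0 // ltW.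
  - by rewrite big_geq // addr_ge0 ?invr_ge0 ?divr_ge0 ?pi_ge0 // ltW.
  rewrite big_add1 /= big_ltn //=; apply: lerD => //; exact: S.
apply: le_trans (le_normcD _ _) _.
apply: le_trans (lerD hf0 (ler_normc_sum _ _ _)) _.
have h : \sum_(1 <= n < M) normc (f n) <=
    \sum_(1 <= n < M) lorentz y n + \sum_(1 <= n < M) lorentz y n.-1.
  by rewrite -big_split /= !big_nat; apply: ler_sum => n /andP[n0 _]; exact: hf.
have := S M; move: S' g0 h.
have -> : (pi + 2) / y = y^-1 + (pi / 2 / y + (y^-1 + pi / 2 / y)) by field; rewrite gt_eqF.
lra.
Qed.

Lemma re_shift_bounds z n : 0 <= Re z <= 1 -> (0 < n)%N ->
  n%:R <= `|Re (z + n%:R)| /\ n.-1%:R <= `|Re (z - n%:R)|.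
Proof.
move=> /andP[x0 x1]; case: n => // n _; rewrite !ReD ReN natC /= -natr1.
by split; rewrite ler_normr; apply/orP; [left|right]; lra.
Qed.

Lemma Im_shift z n : Im (z + n%:R) = Im z /\ Im (z - n%:R) = Im z.
Proof. by rewrite !ImD ImN natC /= oppr0 addr0. Qed.

(** Every translate has modulus at least [Im z >= 1], so its inverse to the power [N] is bounded by
    the inverse square. *)
Lemma phi_decay_ge2 J N z : (2 <= N)%N -> 1 <= Im z -> 0 <= Re z <= 1 ->
  normc (phi J N z) <= (pi + 2) / Im z.
Proof.
move=> N2 y1 x01; have y0 : 0 < Im z by apply: lt_le_trans y1.
have N0 : (0 < N)%N by apply: leq_trans N2.
apply: (normc_lim_le (@cvg_phi R J N z N0)) => M.
have key n (u : C) : Im u = Im z -> n%:R <= `|Re u| -> normc (u ^- N) <= lorentz (Im z) n.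
  move=> uy un; apply: le_trans (normc_inv_sqr_le y0 uy un).
  rewrite -exprVn normcX; apply: ler_wiXn2l => //; rewrite ?normc_ge0 //.
  rewrite normcV invf_le1; last by apply: lt_le_trans (Im_le_normc _); rewrite uy gtr0_norm.
  by apply: le_trans (Im_le_normc _); rewrite uy gtr0_norm.
apply: lorentz_series_le => //; first by apply: key.
move=> n n0; rewrite normcM normc_sign mul1r; apply: le_trans (le_normcD _ _) _.
have [i1 i2] := Im_shift z n; have [r1 r2] := re_shift_bounds x01 n0.
by apply: lerD; apply: key.
Qed.

(** For [N = 1] the terms are not small one by one, but the difference of two inverses at distance
    at most 1 is bounded by the product of the inverses. This transfers the question to the
    imaginary axis. *)
Lemma phi1_vertical_le z : 1 <= Im z -> 0 <= Re z <= 1 ->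
  normc (phi I 1 z - phi I 1 (0 +i* Im z)) <= (pi + 2) / Im z.
Proof.
move=> y1 x01; have y0 : 0 < Im z by apply: lt_le_trans y1.
set z0 := 0 +i* Im z.
apply: (normc_lim_le (cvgB (@cvg_phi R I 1 z isT) (@cvg_phi R I 1 z0 isT))) => M.
rewrite -[X in normc X]/(phi_psum I 1 z M - phi_psum I 1 z0 M).
rewrite /phi_psum opprD addrACA -sumrB.
have x01' : 0 <= Re z0 <= 1 by rewrite /= lexx ler01.
have key n (u v : C) : Im u = Im z -> Im v = Im z -> u - v = (Re z)%:C ->
   n%:R <= `|Re u| -> n%:R <= `|Re v| -> normc (u ^- 1 - v ^- 1) <= lorentz (Im z) n.
  move=> uy vy uv un vn.
  have u0 : u != 0 by apply: contraTneq y0 => u0; rewrite -uy u0 ltxx.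
  have v0 : v != 0 by apply: contraTneq y0 => v0; rewrite -vy v0 ltxx.
  rewrite !expr1.
  have -> : u^-1 - v^-1 = - ((Re z)%:C * (u^-1 * v^-1)).
    by rewrite -uv; field; rewrite u0 v0.
  rewrite normcN !normcM normc_real.
  have h1 := normc_inv_sqr_le y0 uy un; have h2 := normc_inv_sqr_le y0 vy vn.
  have x1 : `|Re z| <= 1 by case/andP: x01 => a b; rewrite ger0_norm.
  have p1 := normc_ge0 u^-1; have p2 := normc_ge0 v^-1.
  apply: le_trans (_ : normc u^-1 * normc v^-1 <= _).
    by rewrite ler_piMl // mulr_ge0.
  by nra.
apply: lorentz_series_le => //.
  by apply: key => //; rewrite /z0; case: (z) => a b; simpc.
move=> n n0; rewrite /phi_term muln0 expr0 !mul1r opprD addrACA.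
have [i1 i2] := Im_shift z n; have [r1 r2] := re_shift_bounds x01 n0.
have [j1 j2] := Im_shift z0 n; have [s1 s2] := re_shift_bounds x01' n0.
have zz0 : z - z0 = (Re z)%:C by rewrite /z0; case: (z) => a b; simpc.
apply: le_trans (le_normcD _ _) _.
by apply: lerD; apply: key => //; rewrite -zz0; ring.
Qed.

(** On the imaginary axis the pair [n], [- n] sums to [- 2 i y / (y ^ 2 + n ^ 2)], and the sum of
    [y / (y ^ 2 + n ^ 2)] misses [pi / 2] by at most [1 / y]. *)
Lemma phi1_imaginary_le y : 1 <= y -> normc (phi I 1 (0 +i* y) + 0 +i* pi) <= 3 / y.
Proof.
move=> y1; have y0 : 0 < y by apply: lt_le_trans y1.
have yC0 : y%:C != 0 by rewrite -normc_gt0 normc_real gtr0_norm.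
have iC0 : 0 +i* (1 : R) != 0 by rewrite eq_complex /= oner_eq0 andbF.
have i2 : (0 +i* (1 : R)) ^+ 2 = -1 by rewrite expr2; simpc.
have E M : phi_psum I 1 (0 +i* y) M =
    - ((0 +i* 1) * (y^-1 + 2 * \sum_(1 <= n < M) y / (y ^+ 2 + n%:R ^+ 2))%:C).
  have inv n : (0 +i* y + n%:R)^-1 + (0 +i* y - n%:R)^-1 =
     - ((0 +i* 1) * (2 * (y / (y ^+ 2 + n%:R ^+ 2)))%:C).
    pose u : C := 0 +i* y + n%:R; pose v : C := 0 +i* y - n%:R; rewrite -/u -/v.
    have D0 : 0 < y ^+ 2 + n%:R ^+ 2 by rewrite ltr_pwDl ?exprn_gt0 ?sqr_ge0.
    have DC0 : (y ^+ 2 + n%:R ^+ 2)%:C != 0 by rewrite -normc_gt0 normc_real gtr0_norm.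
    have uv : u * v = - (y ^+ 2 + n%:R ^+ 2)%:C.
      by rewrite /u /v natC; simpc; congr (_ +i* _); ring.
    have u0 : u != 0.
      by apply: contra_neq DC0 => u0; apply: oppr_inj; rewrite -uv u0 mul0r oppr0.
    have v0 : v != 0.
      by apply: contra_neq DC0 => v0; apply: oppr_inj; rewrite -uv v0 mulr0 oppr0.
    have -> : u^-1 + v^-1 = (u + v) / (u * v) by field; rewrite u0 v0.
    rewrite uv invrN mulrN; congr (- _).
    have -> : u + v = (0 +i* 1) * (2 * y)%:C.
      by rewrite /u /v natC; simpc; congr (_ +i* _); ring.
    rewrite -mulrA; congr (_ * _); rewrite -fmorphV -rmorphM /=; congr (_%:C).
    by rewrite mulrA.
  have inv0 : (0 +i* y)^-1 = - ((0 +i* 1) * (y^-1)%:C).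
    have -> : 0 +i* y = (0 +i* 1) * y%:C by simpc.
    have iV : (0 +i* (1 : R))^-1 = - (0 +i* 1).
      by apply: (mulfI iC0); rewrite divff // mulrN -expr2 i2 opprK.
    by rewrite invfM iV mulNr -fmorphV.
  rewrite /phi_psum expr1 inv0 rmorphD /= mulrDr opprD; congr (_ + _).
  rewrite rmorphM rmorph_sum /= mulr_sumr mulr_sumr -sumrN; apply: eq_bigr => n _.
  by rewrite /phi_term muln0 expr0 mul1r !expr1 inv rmorphM.
have {}E M : normc (phi_psum I 1 (0 +i* y) M + 0 +i* pi) =
    `|pi - (y^-1 + 2 * \sum_(1 <= n < M) y / (y ^+ 2 + n%:R ^+ 2))|.
  rewrite E; set q := _ + _ * _.
  have -> : - ((0 +i* 1) * q%:C) + 0 +i* pi = (0 +i* 1) * (pi - q)%:C.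
    by simpc; congr (_ +i* _); ring.
  rewrite normcM normc_real; suff -> : normc (0 +i* (1 : R)) = 1 by rewrite mul1r.
  by rewrite /normc expr0n /= add0r expr1n sqrtr1.
apply/ler_addgt0Pr => e e0.
have e4 : 0 < e / 4 by rewrite divr_gt0.
have [A [_ hA]] := (cvgrPdist_le _ _).1 (@cvgy_atan R) _ e4.
have [M0 _ hM0] := (cvg_normcP _ _ _).1 (@cvg_phi R I 1 (0 +i* y) isT) _ e4.
pose T := Num.trunc (Num.max A 0 * y).
(* Large enough for the partial sum to be near [phi] and for [M / y > A], where [atan] is near
   [pi / 2]. *)
pose M := (maxn M0 T.+1).+1.
have M0M : (M0 <= M)%N by rewrite /M; lia.
have TM : (T.+1 <= M)%N by rewrite /M; lia.
have := hM0 M M0M.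
have hAM : A < M%:R / y.
  rewrite ltr_pdivlMr //.
  apply: le_lt_trans (_ : Num.max A 0 * y < _).
    by rewrite ler_wpM2r ?(ltW y0) // le_max lexx.
  by apply: lt_le_trans (truncnS_gt _) _; rewrite ler_nat.
have {hA} := hA _ hAM.
have hE := E M.
have Q1 := lorentz_sum_le M y0; have Q2 := lorentz_sum_ge M.-1 y0.
rewrite (_ : M.-1.+1 = M) // in Q2.
move: hE Q1 Q2; set Q := \sum_(1 <= n < M) _ => hE Q1 Q2 h1 h2.
have yi : 0 < y^-1 by rewrite invr_gt0.
have {}hE : normc (phi_psum I 1 (0 +i* y) M + 0 +i* pi) <= 3 / y + e / 2.
  rewrite hE; move: h1; rewrite !ler_norml => /andP[_ h1].
  by apply/andP; split; lra.
have -> : phi I 1 (0 +i* y) + 0 +i* pi =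
   (phi_psum I 1 (0 +i* y) M + 0 +i* pi) - (phi_psum I 1 (0 +i* y) M - phi I 1 (0 +i* y)).
  by ring.
apply: le_trans (le_normcB _ _) _.
by lra.
Qed.

Lemma int_sign_false (k : int) : int_sign R false k = 1.
Proof. by rewrite int_sign.unlock mulr0 expr0z. Qed.

Lemma phi_I_decay N : (0 < N)%N -> exists c : R, 0 <= c /\ forall z, 1 <= Im z ->
  normc (phi I N z + 0 +i* (pi *+ (N == 1%N))) <= c / Im z.
Proof.
move=> N0; exists (pi + 2 + 3); split; first by have := pi_ge0 R; lra.
move=> z y1; have y0 : 0 < Im z by apply: lt_le_trans y1.
pose z1 := z + (- Num.floor (Re z))%:~R.
have -> : phi I N z = phi I N z1 by rewrite /z1 phi_shift // int_sign_false mul1r.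
have zy : Im z = Im z1 by rewrite /z1 ImD intC /= addr0.
rewrite zy in y1 y0 *.
have x01 : 0 <= Re z1 <= 1.
  rewrite /z1 ReD intC /= rmorphN /=.
  have := floor_le (Re z); have := floorD1_gt (Re z); rewrite intrD => h1 h2.
  by apply/andP; split; lra.
move: z1 y1 y0 x01 {zy} => z1 y1 y0 x01.
have y10 : 0 <= (Im z1)^-1 by rewrite invr_ge0 ltW.
have pi0 := pi_ge0 R.
case: N N0 => // -[_|N _].
  rewrite eqxx mulr1n -(subrK (phi I 1 (0 +i* Im z1)) (phi I 1 z1)) -addrA.
  apply: le_trans (le_normcD _ _) _; rewrite mulrDl.
  by apply: lerD; [apply: phi1_vertical_le|apply: phi1_imaginary_le].
rewrite /= mulr0n addr0; apply: le_trans (phi_decay_ge2 I _ y1 x01) _ => //.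
by rewrite ler_wpM2r //; lra.
Qed.

(** The limit of [phi J N] as [s Im z] tends to infinity; [s] is 1 or -1 and selects the upper or
    the lower end. *)
Definition half_lim (s : R) J (N : nat) : C :=
  if J is I then 0 +i* (- s * pi *+ (N == 1%N)) else 0.

(** [phi II] follows from [phi I] at [z / 2] by duplication, whence the threshold 2 instead of 1.
    The lower half plane follows from the upper one by parity. *)
Lemma phi_half_decay s J N : (s = 1 \/ s = -1) -> (0 < N)%N ->
  exists c : R, 0 <= c /\ forall z, 2 <= s * Im z ->
  normc (phi J N z - half_lim s J N) <= c / (s * Im z).
Proof.
move=> s1 N0.
have [c [c0 hc]] : exists c : R, 0 <= c /\ forall z, 2 <= Im z ->
    normc (phi J N z - half_lim 1 J N) <= c / Im z.
  have [c [c0 hc]] := phi_I_decay N0.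
  case: J.
    exists c; split=> // z y2; have -> : half_lim 1 I N = - (0 +i* (pi *+ (N == 1%N))).
      by rewrite /half_lim mulN1r mulNrn; simpc.
    by rewrite opprK hc //; lra.
  exists (3 * c); split=> [|z y2]; first by rewrite mulr_ge0.
  rewrite /half_lim subr0 phi_duplication //.
  pose L : C := 0 +i* (pi *+ (N == 1%N)).
  (* The limits cancel in the duplication formula: for [N = 1] the coefficient is 1, and for larger
     [N] the limit [L] is 0. *)
  have L0 : 2 * 2 ^- N * L - L = 0.
    rewrite /L; case: N N0 {hc L} => // -[_|N _].
      by rewrite expr1 mulfV ?mul1r ?subrr // pnatr_eq0.
    by rewrite /= mulr0n -[0 +i* 0]/(0 : C) mulr0 subrr.
  have -> : 2 * 2 ^- N * phi I N (z / 2) - phi I N z =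
     2 * 2 ^- N * (phi I N (z / 2) + L) - (phi I N z + L).
    clearbody L; move: (2 * 2 ^- N) (phi I N (z / 2)) (phi I N z) L0 => k p q L0.
    have -> : k * (p + L) - (q + L) = k * p - q + (k * L - L) by ring.
    by rewrite L0 addr0.
  have n2 : normc (2 * 2 ^- N : C) <= 1.
    rewrite normcM normcV normcX normc_nat ler_pdivrMr ?exprn_gt0 // mul1r.
    by case: N N0 {hc L L0} => // N _; rewrite exprS ler_peMr // exprn_ege1 // ler1n.
  have z2 : Im (z / 2) = Im z / 2.
    by rewrite (natC R 2) -fmorphV mulrC ImMr mulrC.
  have y0 : 0 < Im z by lra.
  apply: le_trans (le_normcB _ _) _; rewrite normcM.
  have h1 := hc (z / 2); have h2 := hc z; rewrite z2 in h1.
  have {}h1 : normc (phi I N (z / 2) + L) <= c / (Im z / 2).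
    by apply: h1; rewrite ler_pdivlMr // mul1r.
  have {}h2 : normc (phi I N z + L) <= c / Im z.
    by apply: h2; apply: le_trans y2; rewrite ler1n.
  have -> : 3 * c / Im z = 1 * (c / (Im z / 2)) + c / Im z by field; rewrite gt_eqF.
  by apply: lerD => //; apply: ler_pM => //; exact: normc_ge0.
case: s1 => ->; first by exists c; split=> // z; rewrite mul1r; exact: hc.
exists c; split=> // z; rewrite mulN1r -ImN => y2.
have -> : phi J N z - half_lim (-1) J N = (-1) ^+ N * (phi J N (- z) - half_lim 1 J N).
  rewrite phi_parity // mulrBr mulrA -exprMn mulrNN mul1r expr1n mul1r; congr (_ - _).
  rewrite /half_lim; case: J {hc}; last by rewrite mulr0.
  have [->|N1] := eqVneq N 1%N; last by rewrite !mulr0n -[0 +i* 0]/(0 : C) mulr0.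
  by rewrite expr1 mulN1r opprK; simpc.
by rewrite normcM normc_sign mul1r; apply: hc.
Qed.

Definition half_plane (s : R) : set_system C :=
  [set P | exists Y : R, forall z, Y <= s * Im z -> P z].

Global Instance half_plane_filter s : Filter (half_plane s).
Proof.
split; first by exists 0.
  move=> P Q [Y1 h1] [Y2 h2]; exists (Num.max Y1 Y2) => z; rewrite ge_max => /andP[y1 y2].
  by split; [exact: h1|exact: h2].
by move=> P Q PQ [Y h]; exists Y => z /h /PQ.
Qed.

Lemma phi_half_cvg s J N (a : nat) (w : C) : (s = 1 \/ s = -1) -> (0 < a)%N ->
  (0 < N)%N -> phi J N (a%:R * z - w) @[z --> half_plane s] --> half_lim s J N.
Proof.
move=> s1 a0 N0; have [c [c0 hc]] := phi_half_decay J s1 N0.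
(* 2 is the threshold of [phi_half_decay], [c / e] gives the precision, and the last summand offsets
   the translation by [w]. *)
apply/cvg_normcP => e e0; exists (2 + c / e + `|s * Im w|) => z hz.
have ce : 0 <= c / e by rewrite divr_ge0 // ltW.
have a1 : 1 <= a%:R :> R by rewrite ler1n.
have sE : s * Im (a%:R * z - w) = a%:R * (s * Im z) - s * Im w.
  by rewrite ImD ImN natC ImMr; ring.
have w1 := ler_norm (s * Im w); have w0 := normr_ge0 (s * Im w).
have big : 2 + c / e <= s * Im (a%:R * z - w) by rewrite sE; nra.
apply: le_trans (hc _ _) _; first by lra.
rewrite ler_pdivrMr; last by lra.
rewrite mulrC -ler_pdivrMr //; lra.
Qed.

End Decay.

(** * Laurent expansions and poles of Phi *)

(* The coefficient of [t ^ (d - |m|)] in the Laurent expansion of [Phi (z + t)]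
   at [t = 0], where [|m|] is the sum of the [m l]. *)
HB.lock Definition lcoef (R : realType) (r jI : nat) (a m : 'I_r -> nat)
    (w : 'I_r -> R[i]) (d : nat) (z : R[i]) : R[i] :=
  \sum_(L in Rset a w z) \sum_(nu \in @level_set r m d L) summand jI a m w z nu.

Section LocalExpansion.
Variable R : realType.
Local Notation C := R[i].
Local Notation int_sign := (@int_sign R).
Variables (r jI : nat) (a m : 'I_r -> nat) (w : 'I_r -> C).
Hypothesis a_gt0 : forall l, (0 < a l)%N.
Hypothesis m_gt0 : forall l, (0 < m l)%N.
Hypothesis w_strip : forall l, strip (w l).

Local Notation M := (\sum_(l < r) m l)%N.
Local Notation local_poly := (local_poly jI a m w).
Local Notation Phi := (Phi jI a m w).

Local Notation lcoef := (@lcoef R r jI a m w).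

Lemma coef_local_polyE K z d : (d <= K)%N -> (local_poly K z)`_d = lcoef d z.
Proof. by move=> dK; rewrite coef_local_poly // lcoef.unlock. Qed.

Lemma Phi_jet K z : jet (fun t => t ^+ M * Phi (z + t)) (local_poly K z) K.+1.
Proof.
have h : jet (fun t => \prod_(l < r) (t ^+ m l * ((a l)%:R ^+ m l *
    phi (lab jI l) (m l) ((a l)%:R * (z + t) - w l)))) (local_poly K z) K.+1.
  apply: jet_prod => l _.
  by apply: (jet_weaken _ (factor_jet (lab jI l) K z (w l) (a_gt0 l) (m_gt0 l))); lia.
apply: (jet_eq ltr01 _ h) => t _ _.
by rewrite big_split /= prodrXr.
Qed.

Definition regular (z : C) := forall l, ~ Defs.integral ((a l)%:R * z - w l).

Definition regular_poly K z : {poly C} :=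
  \prod_(l < r) \poly_(v < K.+1) A (lab jI l) v z (a l) (m l) (w l).

Lemma local_poly_regular K z : regular z -> local_poly K z = 'X^M * regular_poly K z.
Proof.
move=> zr; transitivity (\prod_(l < r) ('X^(m l) *
    \poly_(v < K.+1) A (lab jI l) v z (a l) (m l) (w l))).
  apply: eq_bigr => l _; rewrite /factor_poly /polar_coef (asboolF (zr l)).
  by rewrite polyC0 add0r.
by rewrite big_split /= prodrXr.
Qed.

Lemma A0_phi J z (b n : nat) (x : C) : (0 < n)%N ->
  A J 0 z b n x = b%:R ^+ n * phi J n (b%:R * z - x).
Proof.
move=> n0; rewrite A_phi_coef // phi_coef.unlock /neg_binom bin0 expr0.
by rewrite !mulr1 mul1r addn0 mulrC.
Qed.

Lemma regular_poly0 K z : (regular_poly K z)`_0 = Phi z.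
Proof.
rewrite /regular_poly coef0_prod; apply: eq_bigr => l _.
by rewrite coef_poly /= A0_phi.
Qed.

Lemma lcoef_regular d z : regular z -> (d < M)%N -> lcoef d z = 0.
Proof.
move=> zr dM; rewrite -(coef_local_polyE z (leqnn d)) local_poly_regular //.
by rewrite coefXnM dM.
Qed.

Lemma lcoefM_regular z : regular z -> lcoef M z = Phi z.
Proof.
move=> zr; rewrite -(coef_local_polyE z (leqnn M)) local_poly_regular //.
by rewrite coefXnM ltnn subnn regular_poly0.
Qed.

Lemma regular_jet K z : regular z ->
  jet (fun t => Phi (z + t)) (regular_poly (M + K) z) K.+1.
Proof.
move=> zr; have := Phi_jet (M + K) z; rewrite local_poly_regular // -addnS.
exact: jet_divX.
Qed.

Lemma finite_radius (I : finType) (P : I -> C -> Prop) :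
  (forall i, exists d : R, 0 < d /\ forall t, t != 0 -> normc t < d -> P i t) ->
  exists d : R, 0 < d /\ forall t, t != 0 -> normc t < d -> forall i, P i t.
Proof.
move=> /choice[d hd]; exists (\big[Num.min/1]_i d i); split.
  by elim/big_ind: _ => // [x y x0 y0|i _]; [rewrite lt_min x0|have [] := hd i].
move=> t t0 td i; have [_] := hd i; apply=> //.
by apply: lt_le_trans td _; rewrite (bigD1 i) //= ge_min lexx.
Qed.

Lemma regular_near z : exists d : R, 0 < d /\
  forall t, t != 0 -> normc t < d -> regular (z + t).
Proof.
apply: finite_radius => l.
have [d [d0 _ hd]] := dist_to_int ((a l)%:R * z - w l).
have aR : 0 < (a l)%:R :> R by rewrite ltr0n.
exists (d / (a l)%:R); split; first by rewrite divr_gt0.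
move=> t t0 td [k hk].
have E : (a l)%:R * z - w l + (- k)%:~R = - ((a l)%:R * t).
  by rewrite rmorphN /= -hk; ring.
have at0 : (a l)%:R * t != 0 by rewrite mulf_neq0 // pnatr_eq0 -lt0n.
have := hd (- k); rewrite E oppr_eq0 => /(_ at0).
rewrite normcN normcM normc_nat leNgt => /negP; apply.
by rewrite mulrC -ltr_pdivlMr.
Qed.

Lemma int_sign_sum (I : Type) (s : seq I) (P : pred I) (F : I -> int) b :
  int_sign b (\sum_(i <- s | P i) F i) = \prod_(i <- s | P i) int_sign b (F i).
Proof.
elim/big_rec2: _ => [|i y x _ <-]; first exact: int_sign0.
exact: int_signD.
Qed.

Lemma int_sign_odd (n : nat) (k : int) : int_sign true (n%:Z * k) = int_sign (odd n) k.
Proof.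
elim: n => [|n IH]; first by rewrite mul0r int_sign0 int_sign_false.
rewrite -addn1 PoszD mulrDl mul1r int_signD IH addn1 /=.
by case: odd; rewrite ?int_signK ?int_sign_false ?mul1r.
Qed.

(** Whether [Phi] changes sign under [z + 1]: each factor with label [II] contributes
    [(-1) ^ a l]. *)
Definition parityII : bool := odd (\sum_(l < r | deltaII jI l) a l).

Lemma local_poly_shift K z (k : int) :
  local_poly K (z + k%:~R) = int_sign parityII k *: local_poly K z.
Proof.
transitivity (\prod_(l < r) ((int_sign (isII (lab jI l)) ((a l)%:Z * k))%:P *
  factor_poly (lab jI l) K z (a l) (m l) (w l))).
  by apply: eq_bigr => l _; rewrite factor_poly_shift // mul_polyC.
rewrite big_split -rmorph_prod /= mul_polyC -/(local_poly K z); congr (_ *: _).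
rewrite /parityII -int_sign_odd (big_morph _ PoszD (erefl (Posz 0))) mulr_suml int_sign_sum.
rewrite [RHS]big_mkcond /=; apply: eq_bigr => l _; rewrite isII_lab.
by case: ifP => // _; exact: int_sign_false.
Qed.

Lemma lcoef_shift d z (k : int) : lcoef d (z + k%:~R) = int_sign parityII k * lcoef d z.
Proof.
by rewrite -!(coef_local_polyE _ (leqnn d)) local_poly_shift coefZ.
Qed.

(* All points of the strip where some factor of [Phi] is singular. *)
Definition candidates : seq C :=
  undup [seq (w l + k%:R) / (a l)%:R | l <- enum 'I_r, k <- iota 0 (a l)].

Lemma candidatesP z : reflect
  (exists l, exists2 k, (k < a l)%N & z = (w l + k%:R) / (a l)%:R) (z \in candidates).
Proof.
rewrite mem_undup; apply: (iffP allpairsPdep) => [[l [k [_]]]|[l [k kl ->]]].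
  by rewrite mem_iota add0n => kl ->; exists l, k.
by exists l, k; split; rewrite ?mem_enum ?mem_iota.
Qed.

Lemma candidates_strip z : z \in candidates -> strip z.
Proof.
move=> /candidatesP[l [k kl ->]]; have /= /andP[w0 w1] := w_strip l.
have aR : 0 < (a l)%:R :> R by rewrite ltr0n.
rewrite /strip /= (natC R (a l)) -fmorphV mulrC ReMr ReD natC /= mulrC.
have k0 : 0 <= k%:R :> R by [].
have ka : k%:R + 1 <= (a l)%:R :> R by rewrite natr1 ler_nat.
by rewrite divr_ge0 ?ltr_pdivrMr //= ?mul1r; lra.
Qed.

Lemma strip_int_eq (z z' : C) (k : int) : strip z -> strip z' -> z = z' + k%:~R -> k = 0.
Proof.
rewrite /strip /= => /andP[h1 h2] /andP[h3 h4] E.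
move: h1 h2; rewrite E ReD intC /= => h1 h2.
have k1 : -1 < k by rewrite -(ltr_int R) mulrN1z; lra.
have k2 : k < 1 by rewrite -(ltr_int R) mulr1z; lra.
by lia.
Qed.

(** If [a l * z - w l] is the integer [j], divide [j] by [a l]: the remainder names the candidate,
    and the quotient is the translation. *)
Lemma singular_candidate z : ~ regular z ->
  exists k : int, z - k%:~R \in candidates /\ (strip z -> k = 0).
Proof.
move=> /existsNP[l /contrapT[j hj]].
have aC : (a l)%:R != 0 :> C by rewrite pnatr_eq0 -lt0n.
have a0 : a l != 0 :> int by have := a_gt0 l; lia.
have aZ : (0 < (a l)%:Z)%R by have := a_gt0 l; lia.
have jm := modz_ge0 j a0; have jl := ltz_pmod j aZ.
pose k := (j %/ (a l)%:Z)%Z.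
have kc : z - k%:~R \in candidates.
  apply/candidatesP; exists l, `|(j %% (a l)%:Z)%Z|%N; first by lia.
  apply: (mulIf aC); rewrite divfK //.
  have -> : (`|(j %% (a l)%:Z)%Z|%:R : C) = (j %% (a l)%:Z)%Z%:~R.
    by rewrite -{2}(gez0_abs jm).
  have jE : j%:~R = k%:~R * (a l)%:R + (j %% (a l)%:Z)%Z%:~R :> C.
    by rewrite {1}(divz_eq j (a l)%:Z) rmorphD rmorphM.
  have -> : (j %% (a l)%:Z)%Z%:~R = j%:~R - k%:~R * (a l)%:R :> C by rewrite jE addrC addKr.
  by rewrite -hj; ring.
exists k; split=> // zs; apply: (strip_int_eq zs (candidates_strip kc)).
by rewrite subrK.
Qed.

End LocalExpansion.

Section Poles.
Variable R : realType.
Local Notation C := R[i].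
Implicit Types (z t : C) (p q : {poly C}).

Lemma near_dnbhsC (z : C) (P : C -> Prop) (d : R) : 0 < d ->
  (forall t, t != 0 -> normc t < d -> P (z + t)) -> \forall y \near z^', P y.
Proof.
move=> d0 h; rewrite near_withinE; apply/nbhs_ballP.
exists d%:C => [/=|y]; first by rewrite ltcR.
rewrite -ball_normE /= distrC normcE ltcR => yz yz0.
have -> : y = z + (y - z) by rewrite addrC subrK.
by apply: h => //; rewrite subr_eq0.
Qed.

Lemma jet_derivable (f : C -> C) z q : q`_0 = f z ->
  jet (fun t => f (z + t)) q 2 -> derivable f z 1.
Proof.
move=> q0 fq.
have {fq}[B [d [B0 d0 h]]] : jet (fun t => f (z + t)) ((f z)%:P + q`_1 *: 'X) 2.
  apply: jet_trunc fq => -[|[|//]] _; rewrite coefD coefC coefZ coefX /=.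
    by rewrite mulr0 addr0.
  by rewrite mulr1 add0r.
apply/cvg_ex; exists q`_1; apply/cvg_normcP => e e0.
have B1 : 0 < B + 1 by rewrite ltr_wpDl.
pose d' := Num.min d (e / (B + 1)).
apply: (@near_dnbhsC 0 _ d'); first by rewrite lt_min d0 divr_gt0.
move=> t t0; rewrite lt_min add0r => /andP[td te].
have := h t t0 td; rewrite hornerD hornerC hornerZ hornerX => ht.
have -> : t^-1 *: (f (t *: 1 + z) - f z) - q`_1 = t^-1 * (f (z + t) - (f z + q`_1 * t)).
  have -> : t *: 1 + z = z + t by rewrite -[t *: 1]/(t * 1) mulr1 addrC.
  by rewrite -[_ *: _]/(_ * _); move: (f _) (f _) => u v; field.
have nt : 0 < normc t by rewrite normc_gt0.
rewrite normcM normcV ler_pdivrMl //; apply: le_trans ht _.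
rewrite expr2 mulrCA ler_pM2l //.
have : normc t * (B + 1) <= e by rewrite -ler_pdivlMr // ltW.
by have := normc_ge0 t; nra.
Qed.

(** The lowest nonzero coefficient, of index [j < K], dominates near 0, so [g] grows at least like
    [t ^- (K - j)], hence like the inverse of [t]. The radius keeps the error below half of that
    coefficient. *)
Lemma jet_norm_ge (g : C -> C) p (K i : nat) : jet (fun t => t ^+ K * g t) p K ->
  (i < K)%N -> p`_i != 0 -> exists c d : R, [/\ 0 < c, 0 < d &
    forall t, t != 0 -> normc t < d -> c / normc t <= normc (g t)].
Proof.
move=> gp iK pi0.
have [j pj0 minj] := ex_minnP (ex_intro (fun i => p`_i != 0) i pi0).
have jK : (j < K)%N by apply: leq_ltn_trans (minj _ pi0) iK.
have pE : p = 'X^j * drop_poly j p.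
  apply/polyP => k; rewrite coefXnM coef_drop_poly; case: ltnP => kj.
    by apply/eqP; apply: contraTT kj => /minj; rewrite -leqNgt.
  by rewrite subnK.
have h1 : jet (fun t => t ^+ (K - j) * g t) (drop_poly j p) 1.
  apply: (@jet_divX _ _ _ j); rewrite -pE; apply: (@jet_weaken _ _ _ K); first by lia.
  apply: (jet_eq ltr01 _ gp) => t _ _.
  by rewrite mulrA -exprD subnKC // ltnW.
have [B [d [B0 d0 h]]] : jet (fun t => t ^+ (K - j) * g t) (p`_j)%:P 1.
  by apply: jet_trunc h1 => -[|//] _; rewrite coefC coef_drop_poly add0n.
have np : 0 < normc p`_j by rewrite normc_gt0.
have B1 : 0 < 2 * (B + 1) by rewrite mulr_gt0 // ltr_wpDl.
exists (normc p`_j / 2), (Num.min (Num.min d 1) (normc p`_j / (2 * (B + 1)))); split.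
- by rewrite divr_gt0.
- by rewrite !lt_min d0 ltr01 divr_gt0.
move=> t t0; rewrite !lt_min => /andP[/andP[td t1] tp].
have nt : 0 < normc t by rewrite normc_gt0.
have := h t t0 td; rewrite hornerC expr1 normcBC => {}h.
have := ler_distc p`_j (t ^+ (K - j) * g t); rewrite normcM normcX => h2.
have h3 : normc t ^+ (K - j) * normc (g t) <= normc t * normc (g t).
  rewrite ler_wpM2r ?normc_ge0 // -[leRHS]expr1; apply: ler_wiXn2l; rewrite ?normc_ge0 ?ltW //.
  by rewrite subn_gt0.
rewrite ler_pdivrMr //.
have : normc t * (2 * (B + 1)) < normc p`_j by rewrite -ltr_pdivlMr.
nra.
Qed.

Lemma norm_pole (f : C -> C) z (c d : R) : 0 < c -> 0 < d ->
  (forall t, t != 0 -> normc t < d -> c / normc t <= normc (f (z + t))) ->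
  (`|f y| : C) @[y --> z^'] --> +oo.
Proof.
move=> c0 d0 h P [M [Mreal hM]].
pose m := Num.max (Re M) 0 + 1.
have m0 : 0 < m by rewrite ltr_wpDl // le_max lexx orbT.
apply: (@near_dnbhsC z _ (Num.min d (c / m))); first by rewrite lt_min d0 divr_gt0.
move=> t t0; rewrite lt_min => /andP[td tm].
apply: hM; rewrite -(RRe_real Mreal) normcE ltcR.
have nt : 0 < normc t by rewrite normc_gt0.
apply: lt_le_trans (h t t0 td).
rewrite ltr_pdivlMr //; apply: le_lt_trans (_ : m * normc t < c).
  rewrite ler_wpM2r ?normc_ge0 // /m; apply: le_trans (_ : Num.max (Re M) 0 <= _).
    by rewrite le_max lexx.
  by rewrite lerDl.
by rewrite mulrC -ltr_pdivlMr.
Qed.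

Variables (r jI : nat) (a m : 'I_r -> nat) (w : 'I_r -> C).
Hypothesis a_gt0 : forall l, (0 < a l)%N.
Hypothesis m_gt0 : forall l, (0 < m l)%N.
Hypothesis w_strip : forall l, strip (w l).
Local Notation M := (\sum_(l < r) m l)%N.

Lemma lcoef_neq0_pole d z : (d < M)%N -> lcoef jI a m w d z != 0 ->
  is_pole (Phi jI a m w) z.
Proof.
move=> dM cd; split.
  have [e [e0 he]] := regular_near w a_gt0 z.
  apply: (near_dnbhsC e0) => t t0 te.
  have zr := he t t0 te.
  have J := regular_jet jI a_gt0 m_gt0 1 zr.
  apply: (@jet_derivable (Phi jI a m w) _ _ _ J).
  exact: regular_poly0.
have := Phi_jet jI w a_gt0 m_gt0 M z; move=> /(jet_weaken (leqnSn M)) h.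
have cd' : (local_poly jI a m w M z)`_d != 0.
  by rewrite coef_local_polyE // ltnW.
have [c [e [c0 e0 hc]]] := jet_norm_ge h dM cd'.
exact: (norm_pole c0 e0 hc).
Qed.

(** A pole that is no candidate is regular and a candidate that is no pole has no polar part, so the
    summand vanishes wherever the two index sets differ. *)
Lemma fsum_poles d (F : C -> C) : (d < M)%N ->
  \sum_(rho \in poles jI a m w) lcoef jI a m w d rho * F rho =
  \sum_(rho <- candidates a w) lcoef jI a m w d rho * F rho.
Proof.
move=> dM; set f := fun rho => lcoef jI a m w d rho * F rho.
rewrite fsbig_supp; apply: fsbig_fwiden; last 2 first.
- exact: undup_uniq.
- move=> rho /= [rc nrho].
  have [//|/eqP fne] := pselect (f rho = 0).
  exfalso; apply: nrho; split; last exact/eqP.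
  split; first exact: candidates_strip rc.
  apply: (lcoef_neq0_pole dM); apply: contraNneq fne => c0.
  by rewrite /f c0 mul0r.
move=> rho /= [[rs _] fne].
have nr : ~ regular a w rho.
  by move=> rr; apply: fne; rewrite /f lcoef_regular // mul0r.
have [k [kc k0]] := singular_candidate a_gt0 w_strip nr.
by move: kc; rewrite (k0 rs) subr0.
Qed.

End Poles.

(** * Partial fractions *)

Section PartialFractions.
Variable R : realType.
Local Notation C := R[i].
Variables (r jI : nat) (a m : 'I_r -> nat) (w : 'I_r -> C).
Hypothesis a_gt0 : forall l, (0 < a l)%N.
Hypothesis m_gt0 : forall l, (0 < m l)%N.
Hypothesis w_strip : forall l, strip (w l).
Variable J : label.
Implicit Types (z rho : C) (K k n i mu : nat) (s : R).
Hypothesis J_parity : isII J = parityII jI a.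

Local Notation M := (\sum_(l < r) m l)%N.
Local Notation Phi := (Phi jI a m w).
Local Notation lcoef := (lcoef jI a m w).
Local Notation cands := (candidates a w).
Local Notation local_poly := (local_poly jI a m w).

Lemma sum_cands_polar i z : (i < M)%N ->
  \sum_(rho <- cands) lcoef i rho * polar_coef (isII J) (1%:R * z - rho) = lcoef i z.
Proof.
move=> iM.
have [zr|nr] := pselect (regular a w z).
  rewrite lcoef_regular // big_seq big1 // => rho rc.
  rewrite /polar_coef; case: asboolP => [[k hk]|_]; last by rewrite mulr0.
  have -> : rho = z + (- k)%:~R by rewrite rmorphN /= -hk mul1r opprB addrC subrK.
  by rewrite lcoef_shift // lcoef_regular // mulr0 mul0r.
have [k [kc _]] := singular_candidate a_gt0 w_strip nr.
rewrite (bigD1_seq (z - k%:~R)) ?undup_uniq //= [X in _ + X]big_seq_cond big1 ?addr0.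
  have -> : 1%:R * z - (z - k%:~R) = k%:~R by rewrite mul1r opprB addrC subrK.
  rewrite polar_coef_int J_parity.
  have {2}-> : z = z - k%:~R + k%:~R by rewrite subrK.
  by rewrite lcoef_shift // mulrC.
move=> rho /andP[rc rk]; rewrite /polar_coef; case: asboolP => [[j hj]|_]; last by rewrite mulr0.
case/eqP: rk; have E : rho = z - k%:~R + (k - j)%:~R.
  by rewrite rmorphB /= -hj mul1r; ring.
have kj := strip_int_eq (candidates_strip a_gt0 w_strip rc)
  (candidates_strip a_gt0 w_strip kc) E.
by rewrite E kj addr0.
Qed.

Definition polar_sum z : C := \sum_(rho <- cands) \sum_(1 <= n < M.+1)
  lcoef (M - n) rho * phi J n (1%:R * z - rho).

Definition reg_coef mu z : C := lcoef (M + mu) z - \sum_(rho <- cands)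
  \sum_(1 <= n < M.+1) lcoef (M - n) rho * A J mu z 1 n rho.

Lemma polar_term_jet K z n rho : (0 < n)%N -> (n <= M)%N ->
  jet (fun t => t ^+ M * phi J n (1%:R * (z + t) - rho))
    ('X^(M - n) * factor_poly J K z 1 n rho) K.+1.
Proof.
move=> n0 nM.
have h := jet_weaken (ltac:(lia) : (K.+1 <= n + K.+1)%N) (factor_jet J K z rho (ltn0Sn 0) n0).
apply: (jet_eq ltr01 _ (jetM (jet_expr R (M - n) K.+1) h)) => t _ _.
by rewrite expr1n mul1r mulrA -exprD subnK.
Qed.

Lemma coef_polar_term K z n rho i : (0 < n)%N -> (n <= M)%N -> (i <= K)%N ->
  ('X^(M - n) * factor_poly J K z 1 n rho)`_i =
   (i == M - n)%N%:R * polar_coef (isII J) (1%:R * z - rho)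
   + (M <= i)%N%:R * A J (i - M) z 1 n rho.
Proof.
move=> n0 nM iK; rewrite coefXnM /factor_poly.
case: ltnP => [iMn|Mni].
  by rewrite ltn_eqF // leqNgt (leq_trans iMn (leq_subr _ _)) /= !mul0r addr0.
rewrite coefD coefC coefXnM; congr (_ + _).
  have -> : (i - (M - n) == 0)%N = (i == M - n)%N by apply/eqP/eqP; lia.
  by case: eqP; rewrite ?mul1r ?mul0r.
have -> : (i - (M - n) < n)%N = ~~ (M <= i)%N by lia.
case: (leqP M i) => Mi /=; last by rewrite mul0r.
have -> : (i - (M - n) - n = i - M)%N by lia.
rewrite coef_poly mul1r ifT //; lia.
Qed.

Lemma difference_jet k z :
  jet (fun t => Phi (z + t) - polar_sum (z + t)) (\poly_(mu < k.+1) reg_coef mu z) k.+1.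
Proof.
pose K := (M + k)%N.
pose p : {poly C} := local_poly K z - \sum_(rho <- cands) \sum_(1 <= n < M.+1)
  lcoef (M - n) rho *: ('X^(M - n) * factor_poly J K z 1 n rho).
apply: (@jet_divX _ _ _ M).
have hp : jet (fun t => t ^+ M * (Phi (z + t) - polar_sum (z + t))) p (M + k.+1).
  rewrite addnS -/K.
  have h2 : jet (fun t => \sum_(rho <- cands) \sum_(n <- index_iota 1 M.+1 | (1 <= n < M.+1)%N)
     lcoef (M - n) rho * (t ^+ M * phi J n (1%:R * (z + t) - rho)))
     (\sum_(rho <- cands) \sum_(n <- index_iota 1 M.+1 | (1 <= n < M.+1)%N)
  lcoef (M - n) rho *: ('X^(M - n) * factor_poly J K z 1 n rho)) K.+1.
    apply: jet_sum => rho _; apply: jet_sum => n /andP[n0 nM].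
    by apply: jetZ; apply: polar_term_jet.
  have -> : p = local_poly K z - \sum_(rho <- cands)
      \sum_(n <- index_iota 1 M.+1 | (1 <= n < M.+1)%N)
        lcoef (M - n) rho *: ('X^(M - n) * factor_poly J K z 1 n rho).
    by congr (_ - _); apply: eq_bigr => rho _; rewrite big_nat.
  apply: (jet_eq ltr01 _ (jetB (Phi_jet jI w a_gt0 m_gt0 K z) h2)) => t _ _.
  rewrite mulrBr; congr (_ - _); rewrite /polar_sum mulr_sumr; apply: eq_bigr => rho _.
  rewrite -big_nat mulr_sumr; apply: eq_bigr => n _; exact: mulrCA.
apply: jet_trunc hp => i iMk.
have iK : (i <= K)%N by rewrite /K; lia.
rewrite coefB coef_sum coef_local_polyE //.
have -> : \sum_(rho <- cands) (\sum_(1 <= n < M.+1)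
     lcoef (M - n) rho *: ('X^(M - n) * factor_poly J K z 1 n rho))`_i =
  \sum_(rho <- cands) \sum_(1 <= n < M.+1) lcoef (M - n) rho *
   ((i == M - n)%N%:R * polar_coef (isII J) (1%:R * z - rho)
   + (M <= i)%N%:R * A J (i - M) z 1 n rho).
  apply: eq_bigr => rho _; rewrite coef_sum !big_nat; apply: eq_bigr => n /andP[n0 nM].
  by rewrite coefZ coef_polar_term.
rewrite coefXnM; case: ltnP => iM.
  have -> : \sum_(rho <- cands) \sum_(1 <= n < M.+1) lcoef (M - n) rho *
     ((i == M - n)%N%:R * polar_coef (isII J) (1%:R * z - rho)
     + (false : nat)%:R * A J (i - M) z 1 n rho) =
    \sum_(rho <- cands) lcoef i rho * polar_coef (isII J) (1%:R * z - rho).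
    apply: eq_bigr => rho _.
    have Mi : (M - i)%N \in index_iota 1 M.+1.
      by rewrite mem_index_iota subn_gt0 iM ltnS leq_subr.
    rewrite (bigD1_seq _ Mi (iota_uniq _ _)) /=.
    have -> : (M - (M - i) = i)%N by lia.
    rewrite eqxx mul1r mul0r addr0 big_seq_cond big1 ?addr0 // => n.
    rewrite mem_index_iota => /andP[/andP[n0 nM] ni].
    have -> : (i == M - n)%N = false.
      apply/negbTE/eqP => E; by move/eqP: ni; apply; rewrite E subKn.
    by rewrite !mul0r addr0 mulr0.
  by rewrite sum_cands_polar // subrr.
rewrite coef_poly ifT; last by lia.
rewrite /reg_coef subnKC //; congr (_ - _).
apply: eq_bigr => rho _; apply: eq_big_nat => n /andP[n0 nM].
have -> : (i == M - n)%N = false by apply/negbTE/eqP; lia.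
by rewrite mul0r add0r mul1r.
Qed.

Lemma reg_coef0_regular z : regular a w z -> reg_coef 0 z = Phi z - polar_sum z.
Proof.
move=> zr; rewrite /reg_coef addn0 lcoefM_regular //; congr (_ - _).
apply: eq_bigr => rho _; apply: eq_big_nat => n /andP[n0 nM].
by rewrite A0_phi // expr1n mul1r.
Qed.

Lemma reg_coef_jet k z :
  jet (fun t => reg_coef 0 (z + t)) (\poly_(mu < k.+1) reg_coef mu z) k.+1.
Proof.
have [d [d0 hd]] := regular_near w a_gt0 z.
apply: (jet_eq d0 _ (difference_jet k z)) => t t0 td.
by rewrite reg_coef0_regular //; exact: hd.
Qed.

Lemma reg_coef_periodic z : reg_coef 0 (z + 2) = reg_coef 0 z.
Proof.
have s2 b : int_sign R b 2%:Z = 1 by rewrite (_ : 2%:Z = 1 + 1) // int_signD int_signK.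
have E1 : lcoef (M + 0) (z + 2%:Z%:~R) = lcoef (M + 0) z.
  by rewrite (lcoef_shift jI a w m_gt0) s2 mul1r.
have E2 rho n : (0 < n)%N -> A J 0 (z + 2%:Z%:~R) 1 n rho = A J 0 z 1 n rho.
  by move=> n0; rewrite (A_shift _ _ _ _ _ _ n0) mul1r s2 mul1r.
rewrite -[z + 2]/(z + 2%:Z%:~R) /reg_coef; refine (congr2 (fun x y => x - y) E1 _).
apply: eq_bigr => rho _; apply: eq_big_nat => n /andP[n0 nM].
exact: (congr1 _ (E2 rho n n0)).
Qed.

Definition end_limit (s : R) : C :=
  \prod_(l < r) ((a l)%:R ^+ m l * half_lim s (lab jI l) (m l))
  - \sum_(rho <- cands) \sum_(1 <= n < M.+1) lcoef (M - n) rho * half_lim s J n.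

Lemma difference_cvg s : (s = 1 \/ s = -1) ->
  (Phi z - polar_sum z) @[z --> half_plane s] --> end_limit s.
Proof.
move=> s1; apply: cvgB.
  apply: cvg_prodC => l; by apply: cvgZC; exact: phi_half_cvg.
rewrite /polar_sum; apply: cvg_sumC => rho _.
under eq_fun do rewrite big_nat; rewrite big_nat.
apply: cvg_sumC => n /andP[n0 _]; apply: cvgZC.
exact: phi_half_cvg.
Qed.

Lemma regular_high : exists Y : R, forall z, Y <= `|Im z| -> regular a w z.
Proof.
exists (\sum_(l < r) `|Im (w l)| + 1) => z hz l [k hk].
have a1 : 1 <= (a l)%:R :> R by rewrite ler1n.
have hw : `|Im (w l)| <= \sum_(l < r) `|Im (w l)|.
  by rewrite (bigD1 l) //= lerDl sumr_ge0.
have := congr1 (@complex.Im R) hk; rewrite ImD ImN natC ImMr intC /= => /eqP.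
rewrite subr_eq0 => /eqP E.
have : (a l)%:R * `|Im z| = `|Im (w l)| by rewrite -E normrM ger0_norm.
have := normr_ge0 (Im z); nra.
Qed.

Lemma reg_coef_cvg s : (s = 1 \/ s = -1) -> forall e : R, 0 < e ->
  exists Y : R, forall z, Y <= s * Im z -> normc (reg_coef 0 z - end_limit s) <= e.
Proof.
move=> s1 e e0; have /cvg_normcP/(_ e e0)[Y1 hY1] := difference_cvg s1.
have [Y2 hY2] := regular_high; exists (Num.max Y1 Y2) => z; rewrite ge_max => /andP[h1 h2].
rewrite reg_coef0_regular; first exact: hY1.
apply: hY2; apply: le_trans h2 _; apply: le_trans (ler_norm _) _.
by rewrite normrM; case: s1 => ->; rewrite ?normrN normr1 mul1r.
Qed.

Lemma reg_coef0_const z : reg_coef 0 z = (end_limit 1 + end_limit (-1)) / 2.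
Proof.
apply: periodic_const.
- exact: reg_coef_periodic.
- move=> y; exists (\poly_(mu < 3) reg_coef mu y); split; last exact: reg_coef_jet.
  by rewrite coef_poly.
- move=> e e0; have [Y hY] := reg_coef_cvg (or_introl erefl) e0.
  by exists Y => y hy; apply: hY; rewrite mul1r.
- move=> e e0; have [Y hY] := reg_coef_cvg (or_intror erefl) e0.
  by exists Y => y hy; apply: hY; rewrite mulN1r lerNr.
Qed.

Lemma end_limit_eq : end_limit 1 = end_limit (-1).
Proof.
have key s : (s = 1 \/ s = -1) -> (end_limit 1 + end_limit (-1)) / 2 = end_limit s.
  move=> s1; apply/eqP; rewrite -subr_eq0 -normc_eq0; apply/eqP/le_anti.
  rewrite normc_ge0 andbT; apply/ler_addgt0Pr => e e0; rewrite add0r.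
  have [Y hY] := reg_coef_cvg s1 e0.
  have := hY (0 +i* (s * Y)); rewrite reg_coef0_const; apply.
  by rewrite /= mulrA -expr2; case: s1 => ->; rewrite ?sqrrN expr1n mul1r.
exact: (etrans (esym (key 1 (or_introl erefl))) (key (-1) (or_intror erefl))).
Qed.

Lemma reg_coef_eq mu z :
  reg_coef mu z = (mu == 0%N)%:R * ((end_limit 1 + end_limit (-1)) / 2).
Proof.
have h := reg_coef_jet mu z.
have {h} : jet (fun=> (end_limit 1 + end_limit (-1)) / 2) (\poly_(i < mu.+1) reg_coef i z) mu.+1.
  by apply: (jet_eq ltr01 _ h) => t _ _; rewrite reg_coef0_const.
move=> /jet_unique/(_ (jet_const _ mu.+1))/(_ (ltnSn mu)).
rewrite coef_poly ltnSn coefC => ->.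
by case: eqP => _; [exact: esym (mul1r _)|exact: esym (mul0r _)].
Qed.

End PartialFractions.

Section LevelSets.
Variables (r : nat) (m : 'I_r -> nat).
Local Notation M := (\sum_(l < r) m l)%N.

Lemma KminusE (n : nat) (L : {set 'I_r}) : (n <= M)%N -> Kminus m n L = @level_set r m (M - n) L.
Proof.
move=> nM.
have ML : (M = \sum_(l in L) m l + \sum_(l in ~: L) m l)%N.
  by rewrite (bigID (mem L)) /=; congr (_ + _)%N; apply: eq_bigl => l; rewrite inE.
apply/seteqP; split=> nu; rewrite /Kminus /level_set /= -!(big_morph _ PoszD (erefl (Posz 0)));
  move: ML nM; move: (\sum_(l < r) m l)%N (\sum_k nu k)%N (\sum_(l in L) m l)%N
  (\sum_(l in ~: L) m l)%N => S S0 S1 S2; lia.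
Qed.

Lemma KplusE (mu : nat) (L : {set 'I_r}) : Kplus m mu L = @level_set r m (M + mu) L.
Proof.
have ML : (M = \sum_(l in L) m l + \sum_(l in ~: L) m l)%N.
  by rewrite (bigID (mem L)) /=; congr (_ + _)%N; apply: eq_bigl => l; rewrite inE.
apply/seteqP; split=> nu; rewrite /Kplus /level_set /= -!(big_morph _ PoszD (erefl (Posz 0)));
  move: ML; move: (\sum_(l < r) m l)%N (\sum_k nu k)%N (\sum_(l in L) m l)%N
  (\sum_(l in ~: L) m l)%N => S S0 S1 S2; lia.
Qed.

End LevelSets.

Section EndLimits.
Variable R : realType.
Local Notation C := R[i].
Variables (r jI jII : nat) (a m : 'I_r -> nat) (w : 'I_r -> C).
Hypothesis jIjII : (jI + jII)%N = r.
Local Notation M := (\sum_(l < r) m l)%N.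
Local Notation J := (if caseI jI a jII then I else II).
Local Notation delta := ((jII == 0%N)%:R * \prod_(l < r) (a l * (m l == 1%N))%N%:R : C).
Local Notation residue_sum := (\sum_(rho <- candidates a w) lcoef jI a m w (M - 1) rho).

Lemma J_parityII : isII J = parityII jI a.
Proof.
rewrite /caseI /parityII; case: eqP => [j0|_] /=; last by case: odd.
rewrite big_pred0 // => l; rewrite /deltaII leqNgt.
by have := ltn_ord l; rewrite -{2}jIjII j0 addn0 => ->.
Qed.

Lemma prod_half_lim (s : R) :
  \prod_(l < r) ((a l)%:R ^+ m l * half_lim s (lab jI l) (m l)) =
  delta * (0 +i* (- s * pi)) ^+ r.
Proof.
case: eqP => [j0|/eqP j0].
  rewrite mul1r -[X in _ ^+ X](card_ord r) -prodr_const -big_split /=.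
  apply: eq_bigr => l _.
  have -> : lab jI l = I.
    rewrite /lab /deltaII leqNgt.
    by have := ltn_ord l; rewrite -{2}jIjII j0 addn0 => ->.
  rewrite /half_lim; case: eqP => [->|_]; first by rewrite expr1 muln1 mulr1n.
  by rewrite muln0 mul0r mulr0n -[0 +i* 0]/(0 : C) mulr0.
have jr : (jI < r)%N by rewrite -jIjII -addn1 leq_add2l lt0n.
by rewrite (bigD1 (Ordinal jr)) //= /lab /deltaII /= leqnn mulr0 !mul0r.
Qed.

Lemma half_lim_sum (s : R) (F : nat -> C) (n0 : nat) : (0 < n0)%N ->
  \sum_(1 <= n < n0.+1) F n * half_lim s I n = F 1%N * (0 +i* (- s * pi)).
Proof.
move=> h; rewrite big_ltn // /half_lim eqxx mulr1n.
rewrite [X in _ + X]big_nat big1 ?addr0 // => n /andP[n1 _].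
by rewrite gtn_eqF // mulr0n -[0 +i* 0]/(0 : C) mulr0.
Qed.

Lemma end_limitE (s : R) : (0 < M)%N -> end_limit jI a m w J s =
  delta * (0 +i* (- s * pi)) ^+ r
  - (caseI jI a jII)%:R * (0 +i* (- s * pi)) * residue_sum.
Proof.
move=> M0; rewrite /end_limit prod_half_lim; congr (_ - _).
case: (caseI jI a jII).
  rewrite mul1r mulr_sumr; apply: eq_bigr => rho _.
  by rewrite half_lim_sum // mulrC.
rewrite !mul0r big1 // => rho _; rewrite big1 // => n _.
by rewrite /half_lim mulr0.
Qed.

Lemma imaginary_expr (y : R) (n : nat) :
  (0 +i* y) ^+ n = (y ^+ n)%:C * (cos (pi * n%:R / 2) +i* sin (pi * n%:R / 2)).
Proof.
elim: n => [|n IH]; first by rewrite mulr0 mul0r cos0 sin0 mul1r.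
have -> : pi * n.+1%:R / 2 = pi * n%:R / 2 + pi / 2 :> R by rewrite -natr1; field.
rewrite exprS IH cosDpihalf sinDpihalf exprS; simpc.
by congr (_ +i* _); ring.
Qed.

Lemma imaginary_exprN (y : R) (n : nat) :
  (0 +i* - y) ^+ n = (y ^+ n)%:C * (cos (pi * n%:R / 2) +i* - sin (pi * n%:R / 2)).
Proof.
have -> : 0 +i* - y = ((0 +i* y)^*)%C by [].
by rewrite -rmorphXn /= imaginary_expr rmorphM /=; simpc.
Qed.

Lemma end_limit_mean : (0 < M)%N ->
  (end_limit jI a m w J 1 + end_limit jI a m w J (-1)) / 2 =
  (cos (pi * r%:R / 2) * pi ^+ r)%:C * delta.
Proof.
move=> M0; rewrite !end_limitE // mulN1r opprK mul1r.
have X : 0 +i* - pi = - (0 +i* pi) :> C by simpc.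
have E : (0 +i* - pi) ^+ r + (0 +i* pi) ^+ r = 2 * (cos (pi * r%:R / 2) * pi ^+ r)%:C :> C.
  by rewrite imaginary_expr imaginary_exprN (natC R 2); simpc; congr (_ +i* _); ring.
have -> : (cos (pi * r%:R / 2) * pi ^+ r)%:C = ((0 +i* - pi) ^+ r + (0 +i* pi) ^+ r) / 2 :> C.
  by rewrite E; field.
by rewrite X; move: delta ((- (0 +i* pi)) ^+ r) ((0 +i* pi) ^+ r) => d x y; field.
Qed.

Lemma residue_sumE : (0 < M)%N -> (0 < r)%N -> caseI jI a jII ->
  end_limit jI a m w J 1 = end_limit jI a m w J (-1) ->
  residue_sum = (pi ^+ r.-1 * sin (pi * r%:R / 2))%:C * delta.
Proof.
move=> M0 r0 cI; rewrite !end_limitE // cI mulN1r opprK !mul1r.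
have X : 0 +i* - pi = - (0 +i* pi) :> C by simpc.
have pi0 : 0 +i* pi != 0 :> C by rewrite eq_complex /= eqxx (gt_eqF (pi_gt0 R)).
have E : (0 +i* pi) ^+ r - (0 +i* - pi) ^+ r =
    2 * (0 +i* pi) * (pi ^+ r.-1 * sin (pi * r%:R / 2))%:C :> C.
  have pir : pi ^+ r = pi * pi ^+ r.-1 :> R by rewrite -exprS prednK.
  rewrite imaginary_expr imaginary_exprN (natC R 2) pir.
  by simpc; congr (_ +i* _); ring.
have alg (d x y T S p : C) : p != 0 -> y - x = 2 * p * S ->
    d * x - - p * T = d * y - p * T -> T = S * d.
  move=> p0 yx h; have h2 : 2 * p * T = 2 * p * (S * d).
    have -> : 2 * p * (S * d) = d * (2 * p * S) by ring.
    rewrite -yx.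
    have -> : 2 * p * T = (d * x - - p * T) - (d * y - p * T) + d * (y - x) by ring.
    by rewrite h; ring.
  by apply: (mulfI _ h2); rewrite mulf_neq0 // pnatr_eq0.
rewrite X => h; rewrite X in E; exact: alg pi0 E h.
Qed.

End EndLimits.

Theorem theorem3p2 (R : realType) (r : nat) (a m : 'I_r -> nat)
    (w : 'I_r -> R[i]) (jI jII : nat) :
  (2 <= r)%N ->
  (forall l, (1 <= a l)%N) ->
  (forall l, (1 <= m l)%N) ->
  (forall l, strip (w l)) ->
  (jI + jII)%N = r ->
  (caseI jI a jII ->
    \sum_(rho \in poles jI a m w) \sum_(L in Rset a w rho)
      \sum_(nu \in Kminus m 1 L) summand jI a m w rho nu
    = (pi ^+ r.-1 * sin (pi * r%:R / 2))%:C
      * (jII == 0%N)%:R * \prod_(l < r) (a l * (m l == 1%N))%N%:R)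
  /\
  (forall (z0 : R[i]) (mu : nat),
    let J := if caseI jI a jII then I else II in
    \sum_(1 <= n < (\sum_(l < r) m l)%N.+1)
      \sum_(rho \in poles jI a m w) \sum_(L in Rset a w rho)
        \sum_(nu \in Kminus m n L) (summand jI a m w rho nu * A J mu z0 1 n rho)
    = - (cos (pi * r%:R / 2) * pi ^+ r)%:C
        * (mu == 0%N)%:R * (jII == 0%N)%:R
        * \prod_(l < r) (a l * (m l == 1%N))%N%:R
      + \sum_(L in Rset a w z0)
          \sum_(nu \in Kplus m mu L) summand jI a m w z0 nu).
Proof.
move=> r2 a0 m0 ws jr; set M := (\sum_(l < r) m l)%N.
have r0 : (0 < r)%N by apply: leq_trans r2.
have M0 : (0 < M)%N.
  by rewrite /M (bigD1 (Ordinal r0)) //= addn_gt0 m0.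
have Jp := J_parityII a jr.
have lcoefE n rho : (n <= M)%N -> \sum_(L in Rset a w rho)
    \sum_(nu \in Kminus m n L) summand jI a m w rho nu = lcoef jI a m w (M - n) rho.
  move=> nM; rewrite lcoef.unlock; apply: eq_bigr => L _.
  by rewrite KminusE.
have eqL := end_limit_eq a0 m0 ws Jp.
split=> [cI|z0 mu J].
  rewrite -[RHS]mulrA -(residue_sumE jr M0 r0 cI eqL).
  transitivity (\sum_(rho \in poles jI a m w) lcoef jI a m w (M - 1) rho * 1).
    by apply: eq_fsbigr => rho _; rewrite mulr1 lcoefE.
  rewrite (fsum_poles jI a0 m0 ws (fun=> 1)); last by rewrite ltn_subrL M0.
  by apply: eq_bigr => rho _; rewrite mulr1.
have := reg_coef_eq a0 m0 ws Jp mu z0; rewrite (end_limit_mean _ _ jr M0) /reg_coef -/J -/M.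
have -> : lcoef jI a m w (M + mu) z0 = \sum_(L in Rset a w z0)
          \sum_(nu \in Kplus m mu L) summand jI a m w z0 nu.
  by rewrite lcoef.unlock; apply: eq_bigr => L _; rewrite KplusE.
have -> : \sum_(rho <- candidates a w) \sum_(1 <= n < M.+1)
    lcoef jI a m w (M - n) rho * A J mu z0 1 n rho =
  \sum_(1 <= n < M.+1) \sum_(rho \in poles jI a m w) \sum_(L in Rset a w rho)
        \sum_(nu \in Kminus m n L) (summand jI a m w rho nu * A J mu z0 1 n rho).
  rewrite exchange_big /=; apply: eq_big_nat => n /andP[n0 nM].
  rewrite -(fsum_poles jI a0 m0 ws); last by rewrite ltn_subrL n0 M0.
  apply: eq_fsbigr => rho _; rewrite -(lcoefE _ _ nM) mulr_suml.
  by apply: eq_bigr => L _; rewrite mulr_fsuml.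
move=> /eqP; rewrite subr_eq => /eqP ->.
move: (\sum_(1 <= n < M.+1) _) (\prod_(l < r) _) (_%:C) => S P c; ring.
Qed.
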